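(* Let $D\subset\mathbb{R}^n$ be open, $I\subset\mathbb{R}$ an interval, and let $f:D\to\mathbb{R}^n$ and $g:I\times D\to\mathbb{R}^n$ be of class $C^r$, $r\ge 2$. Consider the perturbed system $\dot{\mathbf z}=f(\mathbf z)+g(t,\mathbf z)$. Suppose the unperturbed system $\dot{\mathbf z}=f(\mathbf z)$ has a non-trivial $T$-periodic hyperbolic limit cycle $\varphi(t)$, and let $d$ be the A-index of the first variational equation $\dot{\mathbf y}=Df(\varphi(t))\mathbf y$. Then there is a real matrix function $U:\mathbb{R}\to\mathbb{R}^{n\times(n-1)}$ of class $C^r$ satisfying \[ U(t+T)=U(t)\,\big[I_{n-d-1}\oplus(-I_d)\big]\quad\text{for all }t, \] such that, in a neighborhood of the cycle (i.e. for $(\mathbf v,\mathbf w)$ in a sufficiently small neighborhood of $0$), the change of variables $\mathbf z\mapsto(s,\mathbf v,\mathbf w)\in\mathbb{R}\times\mathbb{R}^{n-d-1}\times\mathbb{R}^{d}$ given by \[ \mathbf z=\varphi(s)+U(s)\begin{bmatrix}\mathbf v\\ \mathbf w\end{bmatrix} \] transforms the perturbed system into \[ \begin{aligned} \dot s&=1+\Lambda_0(s,\mathbf v,\mathbf w)+\tilde\Lambda_0(t,s,\mathbf v,\mathbf w),\\ \dot{\mathbf v}&=H_1\mathbf v+\Lambda_1(s,\mathbf v,\mathbf w)+\tilde\Lambda_1(t,s,\mathbf v,\mathbf w),\\ \dot{\mathbf w}&=H_2\mathbf w+\Lambda_2(s,\mathbf v,\mathbf w)+\tilde\Lambda_2(t,s,\mathbf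 v,\mathbf w), \end{aligned} \] where $H_1\in\mathbb{R}^{(n-d-1)\times(n-d-1)}$, $H_2\in\mathbb{R}^{d\times d}$, and: (i) if $\{\lambda_\ell\in\mathbb{C}:\ell=1,\dots,n-1\}$ are the eigenvalues (with multiplicity) of the derivative of the Poincaré map associated to $\varphi$, then the real parts of the eigenvalues (with multiplicity) of $H_1\oplus H_2$ are $\{\tfrac1T\log|\lambda_\ell|:\ell=1,\dots,n-1\}$; (ii) $\Lambda_\ell(s,0,0)=0$ and $\frac{\partial\Lambda_\ell}{\partial(\mathbf v,\mathbf w)}(s,0,0)=0$ for all $s\in\mathbb{R}$ and $\ell\in\{0,1,2\}$; (iii) for $\ell\in\{0,1\}$: $\Lambda_\ell(s+T,\mathbf v,\mathbf w)=\Lambda_\ell(s,\mathbf v,-\mathbf w)$ and $\tilde\Lambda_\ell(t,s+T,\mathbf v,\mathbf w)=\tilde\Lambda_\ell(t,s,\mathbf v,-\mathbf w)$; (iv) $\Lambda_2(s+T,\mathbf v,\mathbf w)=-\Lambda_2(s,\mathbf v,-\mathbf w)$ and $\tilde\Lambda_2(t,s+T,\mathbf v,\mathbf w)=-\tilde\Lambda_2(t,s,\mathbf v,-\mathbf w)$; (v) there is $C>0$ such that $\big\|\tilde\Lambda_\ell(t,s,\mathbf v,\mathbf w)\big\|<C\,\big\|g\big(t,\varphi(s)+U(s)[\mathbf v;\mathbf w]\big)\big\|$ for each $\ell\in\{0,1,2\}$ (on the domain of the new coordinates).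
   Context: Hyperbolic limit cycle: the characteristic multiplier $1$ (associated to $\varphi'(0)$) of the first variational equation along $\varphi$ is simple and all other characteristic multipliers (eigenvalues of the derivative of the Poincaré map) have modulus different from $1$. For a linear $T$-periodic system $\dot{\mathbf x}=A(t)\mathbf x$ with fundamental matrix $\Phi$, the monodromy matrix is $\Phi^{-1}(0)\Phi(T)$ (its Jordan form is independent of $\Phi$). The A-index of such a system is the sum, over each distinct Jordan block of the Jordan normal form of a monodromy matrix that is associated to a real negative eigenvalue and occurs an odd number of times, of the dimension of that block (each such distinct block counted only once). $I_m$ is the $m\times m$ identity, $\oplus$ the block-diagonal direct sum.
   Formalization: In (v) the strict inequality ''<'' is replaced by ''≤'', since the strict bound fails wherever g vanishes (e.g. g = 0); where g ≠ 0 the strict bound follows by enlarging C. T is read as the minimal period of the cycle. *)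

(* Defs.v *)
From HB Require Import structures.
From mathcomp Require Import all_boot all_order all_algebra.
From mathcomp Require Import all_classical all_reals all_analysis.
From mathcomp Require Import complex.

Set Implicit Arguments.
Unset Strict Implicit.
Unset Printing Implicit Defensive.

Import Order.TTheory GRing.Theory Num.Theory.
Import numFieldNormedType.Exports.
Local Open Scope ring_scope.
Local Open Scope classical_set_scope.

Section Defs.
Variable R : realType.

Definition iterD {V W : normedModType R} (vs : seq V) (F : V -> W) : V -> W :=
  foldr (fun v G => fun x => 'D_v G x) F vs.

Definition Ck_open {V W : normedModType R} (k : nat) (O : set V) (F : V -> W) :=
  open O /\
  (forall (vs : seq V) (v : V), (size vs < k)%N ->
     forall x, O x -> derivable (iterD vs F) x v) /\
  (forall vs : seq V, (size vs <= k)%N -> {in O, continuous (iterD vs F)}).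

Definition Ck_on {V W : normedModType R} (k : nat) (S : set V) (F : V -> W) :=
  exists (O : set V) (G : V -> W),
    S `<=` O /\ (forall x, S x -> F x = G x) /\ Ck_open k O G.

Definition jacobian_cV n (F : 'cV[R]_n -> 'cV[R]_n) (x : 'cV[R]_n) : 'M[R]_n :=
  \matrix_(i < n, j < n) ('D_(delta_mx j 0 : 'cV[R]_n) F x) i 0.

Definition periodic_orbit n (D : set 'cV[R]_n) (F : 'cV[R]_n -> 'cV[R]_n)
    (phi : R -> 'cV[R]_n) (T : R) :=
  [/\ 0 < T,
      (forall t, D (phi t)),
      (forall t, derivable phi t 1 /\ derive1 phi t = F (phi t)),
      (forall t, phi (t + T) = phi t) &
      (forall tau, 0 < tau < T -> phi tau <> phi 0)].

Definition fundamental_matrix n (A : R -> 'M[R]_n) (Phi : R -> 'M[R]_n) :=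
  forall t, [/\ derivable Phi t 1, derive1 Phi t = A t *m Phi t &
                Phi t \in unitmx].

Definition monodromy n (Phi : R -> 'M[R]_n) (T : R) : 'M[R]_n :=
  invmx (Phi 0) *m Phi T.

Definition cplx_mx m n (M : 'M[R]_(m, n)) : 'M[R[i]]_(m, n) :=
  map_mx (fun x : R => Complex x 0) M.

Definition cmod (z : R[i]) : R :=
  Num.sqrt (complex.Re z ^+ 2 + complex.Im z ^+ 2).

Definition eigenvalues_mult n (M : 'M[R]_n) (rs : seq R[i]) :=
  char_poly (cplx_mx M) = \prod_(r <- rs) ('X - r%:P).

(* Given the monodromy matrix M, [ls] is the list (with multiplicity) of the
   characteristic multipliers other than the trivial multiplier 1 (associated
   to phi'(0)), i.e. the eigenvalues of the derivative of the Poincare map. *)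
Definition poincare_multipliers n (M : 'M[R]_n) (ls : seq R[i]) :=
  char_poly (cplx_mx M) = ('X - 1) * \prod_(l <- ls) ('X - l%:P).

Definition hyperbolic_monodromy n (M : 'M[R]_n) :=
  exists ls : seq R[i], poincare_multipliers M ls /\
    (forall l, l \in ls -> cmod l != 1).

(* entry (i,j) of the block-diagonal Jordan matrix whose blocks are
   J_k(a) (a on the diagonal, 1 on the superdiagonal) for (a,k) in bs *)
Fixpoint jordan_entry (bs : seq (R[i] * nat)) (i j : nat) : R[i] :=
  match bs with
  | [::] => 0
  | (a, k) :: bs' =>
      if (i < k)%N then
        (if (j < k)%N then
           (if i == j then a else if j == i.+1 then 1 else 0)
         else 0)
      else if (j < k)%N then 0
      else jordan_entry bs' (i - k) (j - k)
  end.

Definition jordan_form n (M : 'M[R[i]]_n) (bs : seq (R[i] * nat)) :=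
  [/\ (forall b, b \in bs -> (0 < b.2)%N),
      sumn (map snd bs) = n &
      exists P : 'M[R[i]]_n, P \in unitmx /\
        forall i j : 'I_n, (invmx P *m M *m P) i j = jordan_entry bs i j].

Definition neg_real (z : R[i]) : bool :=
  (complex.Im z == 0) && (complex.Re z < 0).

Definition A_index_of_jordan (bs : seq (R[i] * nat)) : nat :=
  (\sum_(b <- undup bs | neg_real b.1 && odd (count_mem b bs)) b.2)%N.

Definition A_index n (A : R -> 'M[R]_n) (T : R) (d : nat) :=
  exists (Phi : R -> 'M[R]_n) (bs : seq (R[i] * nat)),
    [/\ fundamental_matrix A Phi,
        jordan_form (cplx_mx (monodromy Phi T)) bs &
        d = A_index_of_jordan bs].

Definition solves_on n (J : set R) (F : R -> 'cV[R]_n -> 'cV[R]_n)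
    (z : R -> 'cV[R]_n) :=
  forall t, J t -> derivable z t 1 /\ derive1 z t = F t (z t).

Definition zero_diff_at0 p (W : normedModType R) (F : 'cV[R]_p -> W) :=
  differentiable F 0 /\ ('d F 0 = \0 :> ('cV[R]_p -> W)).

End Defs.

(* Main.v *)
Require Import Defs.
From HB Require Import structures.
From mathcomp Require Import all_boot all_order all_algebra.
From mathcomp Require Import all_classical all_reals all_analysis.
From mathcomp Require Import perm complex zify ring lra.

(** By Floquet theory with a real logarithm. A fundamental matrix satisfies
    [Phi (t + T) = Phi t M], and [phi'] spans the eigenline of [M] for the simple
    multiplier 1. On a complement, [M] is similar over the reals to
    [exp (T H1) (+) - exp (T H2)]: positive Jordan blocks and pairs of (conjugate or
    repeated negative) blocks have real logarithms, and the blocks with negative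
    eigenvalue left unpaired, whose sizes add up to the A-index, have one after a
    change of sign. With [Q] a basis of the complement,
    [U t = Phi t Q exp (- t H)] satisfies [U' = A U - U H], hence is of class [C^r],
    and [U (t + T) = U t (I (+) - I)].

    In the coordinates [z = phi s + U s x] the velocity is [B (s', x')] with
    [B = [phi' + U' x | U]] a rank one perturbation of the invertible
    [[phi' | U]], so it is inverted explicitly, and uniformly for small [x] by
    compactness of the cycle; the linear part of the result is [(1, H x)] because
    [U' + U H = A U]. *)

Set Implicit Arguments.
Unset Strict Implicit.
Unset Printing Implicit Defensive.
Import Order.TTheory GRing.Theory Num.Theory.
Import numFieldNormedType.Exports.
Local Open Scope ring_scope.
Local Open Scope classical_set_scope.

(** The A-index counts complex Jordan blocks, whereas [U], [H1] and [H2] must be real. The blocks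
    are therefore paired in a complex Jordan form, and the resulting similarity is brought back to
    the reals. Pairing requires a block and its conjugate to be equally frequent: the number of
    blocks of each size is determined by ranks of powers, and entrywise conjugation fixes a real
    matrix and preserves ranks. Two equal negative blocks are treated exactly like a conjugate pair,
    the rotation angle being a half-turn. Removing them leaves all parities unchanged, so what
    survives is one copy of each negative block of odd multiplicity, which is what the A-index
    measures. No general matrix exponential is used. A logarithm is witnessed by an explicit curve
    [E] with [E' = H E], built block by block from terminating series; its value at [T] is only
    similar to the wanted Jordan block, which suffices. The sign change [S] is an involution that
    commutes with [H] and does not increase the norm, so bounds on one period hold for all [s].
    Inverting the velocity is additive in [z'], so the terms from [f] and from [g] separate, and one
    constant serves all bounds in (v). *)

Local Notation dsum A B := (block_mx A 0 0 B).

(** * Similarity and Jordan blocks *)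

Section Similarity.
Variable F : fieldType.

(* Similarity between square matrices whose sizes are only propositionally
   equal: the base change and its inverse are rectangular, so no cast occurs. *)
Definition similar_mx m n (A : 'M[F]_m) (B : 'M[F]_n) :=
  exists P Q, [/\ P *m Q = 1%:M, Q *m P = 1%:M & A *m P = P *m B].

Lemma similar_refl m (A : 'M[F]_m) : similar_mx A A.
Proof. by exists 1%:M, 1%:M; rewrite !mulmx1 mul1mx. Qed.

Lemma similar_sym m n (A : 'M[F]_m) (B : 'M[F]_n) :
  similar_mx A B -> similar_mx B A.
Proof.
move=> [P [Q [PQ QP AP]]]; exists Q, P; split=> //.
by rewrite -[LHS]mul1mx -QP -mulmxA [P *m _]mulmxA -AP -!mulmxA PQ mulmx1.
Qed.

Lemma similar_trans m n p (A : 'M[F]_m) (B : 'M[F]_n) (C : 'M[F]_p) :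
  similar_mx A B -> similar_mx B C -> similar_mx A C.
Proof.
move=> [P [Q [PQ QP AP]]] [P' [Q' [PQ' QP' AP']]].
exists (P *m P'), (Q' *m Q); split.
- by rewrite -mulmxA [P' *m _]mulmxA PQ' mul1mx.
- by rewrite -mulmxA [Q *m _]mulmxA QP mul1mx.
- by rewrite mulmxA AP -mulmxA AP' mulmxA.
Qed.

Lemma similar_dim m n (A : 'M[F]_m) (B : 'M[F]_n) : similar_mx A B -> m = n.
Proof.
move=> [P [Q [PQ QP _]]].
have h1 := mxrankM_maxl P Q; have h2 := mxrankM_maxl Q P.
have h3 := mxrankM_maxr P Q; have h4 := mxrankM_maxr Q P.
move: h1 h2 h3 h4; rewrite PQ QP !mxrank1.
have := rank_leq_row P; have := rank_leq_row Q; lia.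
Qed.

Lemma similar_unitmx n (A B P : 'M[F]_n) :
  P \in unitmx -> A *m P = P *m B -> similar_mx A B.
Proof.
by move=> uP AP; exists P, (invmx P); rewrite mulmxV // mulVmx.
Qed.

Lemma similar_unitmxP n (A B : 'M[F]_n) :
  similar_mx A B -> exists2 P, P \in unitmx & A *m P = P *m B.
Proof.
by move=> [P [Q [PQ QP AP]]]; exists P => //; case: (mulmx1_unit PQ).
Qed.

Lemma similar_addscalar m n (A : 'M[F]_m) (B : 'M[F]_n) a :
  similar_mx A B -> similar_mx (A + a%:M) (B + a%:M).
Proof.
move=> [P [Q [PQ QP AP]]]; exists P, Q; split=> //.
by rewrite mulmxDl mulmxDr AP mul_scalar_mx mul_mx_scalar.
Qed.

Lemma similar_exp n (A : 'M[F]_n) m (B : 'M[F]_m) k :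
  similar_mx A B -> similar_mx (A ^+ k) (B ^+ k).
Proof.
move=> [P [Q [PQ QP AP]]]; exists P, Q; split=> //.
elim: k => [|k IH]; first by rewrite !expr0 mul1mx mulmx1.
by rewrite exprS -mulmxE -mulmxA IH mulmxA AP -mulmxA exprS.
Qed.

Lemma similar_rank m n (A : 'M[F]_m) (B : 'M[F]_n) :
  similar_mx A B -> \rank A = \rank B.
Proof.
have le a b (X : 'M[F]_a) (Y : 'M[F]_b) : similar_mx X Y -> (\rank X <= \rank Y)%N.
  move=> /similar_sym [P [Q [PQ QP YP]]].
  have -> : X = Q *m (Y *m P) by rewrite YP mulmxA QP mul1mx.
  by apply: leq_trans (mxrankM_maxr _ _) _; apply: mxrankM_maxl.
by move=> sAB; apply/eqP; rewrite eqn_leq !le //; apply: similar_sym.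
Qed.

Lemma similar_char_poly m n (A : 'M[F]_m) (B : 'M[F]_n) :
  similar_mx A B -> char_poly A = char_poly B.
Proof.
move=> sAB; have e := similar_dim sAB; subst m.
move: sAB => [P [Q [PQ QP AP]]].
have -> : A = P *m B *m Q by rewrite -AP -mulmxA PQ mulmx1.
rewrite /char_poly /char_poly_mx.
have -> : 'X%:M - map_mx polyC (P *m B *m Q) =
   map_mx polyC P *m ('X%:M - map_mx polyC B) *m map_mx polyC Q :> 'M[{poly F}]_n.
  rewrite mulmxBr mulmxBl !map_mxM; congr (_ - _).
  rewrite scalar_mxC -mulmxA -map_mxM PQ.
  by rewrite (_ : map_mx _ 1%:M = 1%:M) ?mulmx1 // (map_mx1 (@polyC F)).
rewrite !det_mulmx mulrAC -det_mulmx -map_mxM PQ.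
by rewrite (_ : map_mx _ 1%:M = 1%:M) ?det1 ?mul1r // (map_mx1 (@polyC F)).
Qed.

Lemma mul_dsum m1 m2 n1 n2 p1 p2 (A : 'M[F]_(m1, n1)) (B : 'M[F]_(m2, n2))
    (C : 'M[F]_(n1, p1)) (D : 'M[F]_(n2, p2)) :
  dsum A B *m dsum C D = dsum (A *m C) (B *m D).
Proof. by rewrite mulmx_block !mulmx0 !mul0mx !addr0 !add0r. Qed.

Lemma similar_dsum m n p q (A : 'M[F]_m) (B : 'M[F]_n) (C : 'M[F]_p) (D : 'M[F]_q) :
  similar_mx A B -> similar_mx C D -> similar_mx (dsum A C) (dsum B D).
Proof.
move=> [P [Q [PQ QP AP]]] [P' [Q' [PQ' QP' AP']]].
exists (dsum P P'), (dsum Q Q'); rewrite !mul_dsum PQ QP PQ' QP' AP AP'.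
by rewrite -!scalar_mx_block.
Qed.

Lemma similar_dsumC m n (A : 'M[F]_m) (B : 'M[F]_n) :
  similar_mx (dsum A B) (dsum B A).
Proof.
exists (block_mx 0 1%:M 1%:M 0), (block_mx 0 1%:M 1%:M 0).
by rewrite !mulmx_block !(mulmx0, mul0mx, mulmx1, mul1mx, addr0, add0r)
  -!scalar_mx_block.
Qed.

Lemma similar_castmx m n (e : m = n) (A : 'M[F]_m) : similar_mx A (castmx (e, e) A).
Proof. by case: _ / e; rewrite castmx_id; apply: similar_refl. Qed.

Lemma similar_dsumA m n p (A : 'M[F]_m) (B : 'M[F]_n) (C : 'M[F]_p) :
  similar_mx (dsum A (dsum B C)) (dsum (dsum A B) C).
Proof.
have := @block_mxA F _ _ _ _ _ _ A 0 0 0 B 0 0 0 C.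
rewrite !row_mx0 !col_mx0 /= => ->.
exact/similar_sym/similar_castmx.
Qed.

Lemma similar_dsumCA m n p (A : 'M[F]_m) (B : 'M[F]_n) (C : 'M[F]_p) :
  similar_mx (dsum A (dsum B C)) (dsum B (dsum A C)).
Proof.
apply: similar_trans (similar_dsumA _ _ _) _.
apply: similar_trans _ (similar_sym (similar_dsumA _ _ _)).
by apply: similar_dsum; [apply: similar_dsumC | apply: similar_refl].
Qed.

Lemma char_poly_dsum m n (A : 'M[F]_m) (B : 'M[F]_n) :
  char_poly (dsum A B) = char_poly A * char_poly B.
Proof. by rewrite /char_poly char_block_diag_mx det_ublock. Qed.

Lemma char_poly_tr n (A : 'M[F]_n) : char_poly A^T = char_poly A.
Proof.
rewrite /char_poly -det_tr; congr (\det _).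
by rewrite /char_poly_mx raddfB /= tr_scalar_mx map_trmx trmxK.
Qed.

(** The [j]-th power of the nilpotent block, in closed form so that ranks of powers can be read
    off. *)
Definition shift_mx k j : 'M[F]_k := \matrix_(i, l) (l == i + j :> nat)%N%:R.

Definition jordan_block (b : F * nat) : 'M[F]_b.2 := (b.1)%:M + shift_mx b.2 1.

Lemma mul_shift_mx k j n (A : 'M[F]_(k, n)) i l :
  (shift_mx k j *m A) i l = if insub (i + j)%N is Some i' then A i' l else 0.
Proof.
rewrite mxE; case: insubP => [i' _ Ei'|Hij].
  rewrite (bigD1 i') //= mxE Ei' eqxx mul1r big1 ?addr0 // => m /negPf ne.
  by rewrite mxE -Ei' val_eqE ne mul0r.
rewrite big1 // => m _; rewrite mxE; case: eqP => [E|]; last by rewrite mul0r.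
by move: Hij; rewrite -E ltn_ord.
Qed.

Lemma mul_mx_shift k j n (A : 'M[F]_(n, k)) i (l : 'I_k) :
  (A *m shift_mx k j) i l =
    if (j <= l)%N then (if insub (l - j)%N is Some l' then A i l' else 0) else 0.
Proof.
rewrite mxE; case: ifP => Hjl; last first.
  by rewrite big1 // => m _; rewrite mxE; case: eqP => [|]; rewrite ?mulr0 //; lia.
case: insubP => [l' _ El'|]; last by have := ltn_ord l; lia.
rewrite (bigD1 l') //= mxE El' subnK // eqxx mulr1 big1 ?addr0 // => m ne.
rewrite mxE; case: eqP => [|]; rewrite ?mulr0 // => E.
by case/eqP: ne; apply: val_inj; rewrite /= El' E addnK.
Qed.

Lemma shift_mx_exp k j : shift_mx k 1 ^+ j = shift_mx k j.
Proof.
elim: j => [|j IH].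
  by rewrite expr0; apply/matrixP=> i l; rewrite !mxE addn0 eq_sym.
rewrite exprS -mulmxE IH; apply/matrixP=> i l; rewrite mul_shift_mx.
case: insubP => [i' _ Ei'|]; rewrite !mxE; first by rewrite Ei' addnAC addn1 addnS.
by move=> H; case: eqP => //; have := ltn_ord l; lia.
Qed.

(** Left multiplication by [pid_mx (k - j)] fixes the matrix, which bounds the rank above; the
    product with the transpose is [pid_mx (k - j)], which bounds it below. *)
Lemma rank_shift_mx k j : \rank (shift_mx k j) = (k - j)%N.
Proof.
apply/eqP; rewrite eqn_leq; apply/andP; split.
  have -> : shift_mx k j = pid_mx (k - j) *m shift_mx k j.
    apply/matrixP=> i l; rewrite mul_mx_shift !mxE; case: ifP => Hl.
      case: insubP => [l' _ El'|]; last by have := ltn_ord l; lia.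
      rewrite !mxE El'; congr ((_ : bool)%:R); have := ltn_ord l; lia.
    by case: eqP => //; lia.
  apply: leq_trans (mxrankM_maxl _ _) _.
  by rewrite rank_pid_mx ?leq_subr.
have <- : \rank (shift_mx k j *m (shift_mx k j)^T) = (k - j)%N.
  have -> : shift_mx k j *m (shift_mx k j)^T = pid_mx (k - j).
    apply/matrixP=> i l; rewrite mul_shift_mx.
    case: insubP => [i' Hi' Ei'|]; rewrite !mxE.
      by congr ((_ : bool)%:R); rewrite Ei'; move: Hi'; lia.
    by move=> H; case: eqP => //= _; case: (ltnP i (k - j)) => //; lia.
  by rewrite rank_pid_mx ?leq_subr.
exact: mxrankM_maxl.
Qed.

(** [is_trig_mx] means lower triangular, hence the transpose. *)
Lemma jordan_block_tr_trig b : is_trig_mx (jordan_block b)^T.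
Proof.
apply/is_trig_mxP => i j lt_ij; rewrite !mxE.
rewrite -val_eqE /= gtn_eqF // mulr0n add0r; case: eqP => //; lia.
Qed.

Lemma jordan_block_diag b i : jordan_block b i i = b.1.
Proof. by rewrite !mxE eqxx; case: eqP => //=; rewrite ?addr0 //; lia. Qed.

Lemma char_poly_jordan_block b : char_poly (jordan_block b) = ('X - (b.1)%:P) ^+ b.2.
Proof.
rewrite -char_poly_tr char_poly_trig ?jordan_block_tr_trig //.
rewrite (eq_bigr (fun => 'X - (b.1)%:P)) => [|i _].
  by rewrite prodr_const card_ord.
by rewrite mxE jordan_block_diag.
Qed.

Lemma rank_jordan_block_exp b a j :
  \rank ((jordan_block b - a%:M) ^+ j) = (if b.1 == a then b.2 - j else b.2)%N.
Proof.
case: eqP => [<-|/eqP ne].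
  by rewrite /jordan_block addrC addKr shift_mx_exp rank_shift_mx.
apply/eqP; rewrite -[_ == _]/(row_free _) row_free_unit.
suff: (jordan_block b - a%:M) \in unitmx.
  move=> u; elim: j => [|j IH]; first by rewrite expr0 unitmx1.
  by rewrite exprS -mulmxE unitmx_mul u.
have -> : jordan_block b - a%:M = jordan_block (b.1 - a, b.2).
  by rewrite /jordan_block /= raddfB addrAC.
rewrite -unitmx_tr unitmxE det_trig;
  last exact: (jordan_block_tr_trig (b.1 - a, b.2)).
rewrite (eq_bigr (fun => b.1 - a)) => [|i _]; last first.
  by rewrite mxE (@jordan_block_diag (b.1 - a, b.2)).
by rewrite prodr_const unitrX // unitfE subr_eq0.
Qed.

Fixpoint jordan_mx (bs : seq (F * nat)) : 'M[F]_(sumn (map snd bs)) :=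
  if bs is b :: bs' then dsum (jordan_block b) (jordan_mx bs') else 0.

Lemma similar_jordan_mx_perm bs1 bs2 :
  perm_eq bs1 bs2 -> similar_mx (jordan_mx bs1) (jordan_mx bs2).
Proof.
have front b bs : b \in bs ->
    similar_mx (jordan_mx bs) (jordan_mx (b :: rem b bs)).
  elim: bs => //= c bs IH; rewrite inE eq_sym; case: eqP => [-> _|_ /= /IH s].
    exact: similar_refl.
  apply: similar_trans (similar_dsum (similar_refl _) s) _.
  exact: similar_dsumCA.
elim: bs1 bs2 => [|b bs1 IH] bs2 pe.
  by move: pe; rewrite perm_sym => /perm_nilP ->; apply: similar_refl.
have bin : b \in bs2 by rewrite -(perm_mem pe) mem_head.
apply: similar_trans (similar_sym (front _ _ bin)).
apply: similar_dsum; first exact: similar_refl.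
by apply: IH; rewrite -(perm_cons b) (perm_trans pe) // perm_to_rem.
Qed.

Lemma char_poly_jordan_mx bs :
  char_poly (jordan_mx bs) =
  \prod_(a <- flatten [seq nseq b.2 b.1 | b <- bs]) ('X - a%:P).
Proof.
elim: bs => [|b bs IH] /=; first by rewrite big_nil /char_poly det_mx00.
by rewrite char_poly_dsum IH char_poly_jordan_block big_cat big_nseq /= -Monoid.iteropE.
Qed.

Lemma exp_dsum m n (A : 'M[F]_m) (B : 'M[F]_n) j :
  dsum A B ^+ j = dsum (A ^+ j) (B ^+ j).
Proof.
elim: j => [|j IH]; first by rewrite !expr0 -scalar_mx_block.
by rewrite !exprS IH -!mulmxE mul_dsum.
Qed.

Definition jordan_rank (bs : seq (F * nat)) a j :=
  (\sum_(b <- bs) (if b.1 == a then b.2 - j else b.2))%N.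

Lemma rank_jordan_mx_exp bs a j :
  \rank ((jordan_mx bs - a%:M) ^+ j) = jordan_rank bs a j.
Proof.
rewrite /jordan_rank; elim: bs => [|b bs IH] /=.
  by rewrite big_nil; apply/eqP; rewrite -leqn0 rank_leq_row.
rewrite big_cons -IH -rank_jordan_block_exp -rank_diag_block_mx -exp_dsum.
by rewrite scalar_mx_block opp_block_mx add_block_mx !subr0.
Qed.

(* The number of Jordan blocks of a given size is the second difference of the
   ranks of the powers. *)
Lemma count_jordan_rank bs a k :
  (jordan_rank bs a k + jordan_rank bs a k.+2 =
   (jordan_rank bs a k.+1).*2 + count_mem (a, k.+1) bs)%N.
Proof.
rewrite /jordan_rank; elim: bs => [|[b m] bs IH]; first by rewrite !big_nil.
rewrite !big_cons /= xpair_eqE.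
move: IH; set x := bigop _ _ _; set y := bigop _ _ _; set z := bigop _ _ _.
set c := count _ _; clearbody x y z c => IH.
by case: (b == a) => /=; case: (eqVneq m k.+1) => /= ?; lia.
Qed.

(** The first basis row vector is cyclic: its images under the powers of [M], stacked as the rows of
    [P], form an upper triangular matrix with nonzero diagonal, and multiplication by [M] sends each
    row to the next and the last one to 0. *)
Lemma similar_strict_upper k (M : 'M[F]_k) :
  (forall i j : 'I_k, (j <= i)%N -> M i j = 0) ->
  (forall i j : 'I_k, j = i.+1 :> nat -> M i j != 0) ->
  similar_mx M (shift_mx k 1).
Proof.
case: k M => [|k] M up sup.
  by rewrite [shift_mx _ _](_ : _ = M); [apply: similar_refl|apply/matrixP=> -[]].
have powE i (l : 'I_k.+1) : (M ^+ i.+1) ord0 l = \sum_m (M ^+ i) ord0 m * M m l.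
  by rewrite exprSr -mulmxE mxE.
have lo i (l : 'I_k.+1) : (l < i)%N -> (M ^+ i) ord0 l = 0.
  elim: i l => // i IH l li; rewrite powE big1 // => m _.
  case: (ltnP m i) => [/IH ->|im]; first by rewrite mul0r.
  by rewrite up ?mulr0 //; lia.
have di i (l : 'I_k.+1) : l = i :> nat -> (M ^+ i) ord0 l != 0.
  elim: i l => [|i IH] l li.
    by rewrite expr0 mxE (_ : l = ord0) ?eqxx ?oner_neq0 //; apply: val_inj.
  have ik : (i < k.+1)%N by rewrite (ltn_trans _ (ltn_ord l)) ?li.
  rewrite powE (bigD1 (Ordinal ik)) //= big1 => [|m ne].
    by rewrite addr0 mulf_neq0 ?IH ?sup.
  case: (ltngtP m i) => mi; first by rewrite lo ?mul0r.
    by rewrite up ?mulr0 //; lia.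
  by case/eqP: ne; apply: val_inj.
pose P : 'M[F]_k.+1 := \matrix_(i, l) (M ^+ i) ord0 l.
apply: similar_sym; apply: (@similar_unitmx _ _ _ P).
  rewrite -unitmx_tr unitmxE det_trig.
    by rewrite unitfE; apply/prodf_neq0 => i _; rewrite !mxE; apply: di.
  by apply/is_trig_mxP => i j ij; rewrite !mxE lo.
apply/matrixP=> i l; rewrite mul_shift_mx.
have -> : (P *m M) i l = (M ^+ i.+1) ord0 l.
  by rewrite powE mxE; apply: eq_bigr => m _; rewrite mxE.
case: insubP => [i' _ Ei'|]; first by rewrite mxE Ei' addn1.
by rewrite addn1 => H; rewrite lo //; have := ltn_ord l; lia.
Qed.

End Similarity.

(** * Matrix-valued curves *)

Section MatrixCalculus.
Variable R : realType.

Lemma mx_entry_norm m n (M : 'M[R]_(m, n)) i j : `|M i j| <= `|M|.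
Proof.
rewrite [leRHS]/Num.Def.normr /= mx_normrE.
by apply: le_trans (le_bigmax _ (fun k : 'I_m * 'I_n => `|M k.1 k.2|) (i, j)).
Qed.

Lemma mx_norm_le m n (M : 'M[R]_(m, n)) e :
  0 <= e -> (forall i j, `|M i j| <= e) -> `|M| <= e.
Proof.
move=> e0 Me; rewrite [leLHS]/Num.Def.normr /= mx_normrE.
by apply: bigmax_le => // -[i j] _; apply: Me.
Qed.

Lemma mx_norm_mulmx m n p (A : 'M[R]_(m, n)) (B : 'M[R]_(n, p)) :
  `|A *m B| <= n%:R * `|A| * `|B|.
Proof.
apply: mx_norm_le => [|i j]; first by rewrite !mulr_ge0.
rewrite mxE; apply: le_trans (ler_norm_sum _ _ _) _.
rewrite -[n in n%:R]card_ord -mulrA mulr_natl -sumr_const.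
apply: ler_sum => k _; rewrite normrM ler_pM // mx_entry_norm //.
Qed.

Lemma cvg_mxP (X : Type) (F : set_system X) {FF : Filter F} m n
    (f : X -> 'M[R]_(m, n)) (l : 'M[R]_(m, n)) :
  f @ F --> l <-> forall i j, (fun x => f x i j) @ F --> l i j.
Proof.
split=> [fl i j|fl].
  apply/cvgrPdist_le => e e0; move/cvgrPdist_le : fl => /(_ _ e0).
  apply: filterS => x; apply: le_trans.
  by rewrite -[leLHS](_ : `|(l - f x) i j| = _) ?mx_entry_norm // !mxE.
apply/cvgrPdist_le => e e0.
have fl' : forall ij : 'I_m * 'I_n, \forall x \near F, `|l ij.1 ij.2 - f x ij.1 ij.2| <= e.
  by move=> [i j]; move/cvgrPdist_le : (fl i j) => /(_ _ e0).
have := filter_forall FF fl'.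
apply: filterS => x H; apply: mx_norm_le; first exact: ltW.
by move=> i j; rewrite !mxE; apply: (H (i, j)).
Qed.

Lemma continuous_mxP (X : topologicalType) m n (f : X -> 'M[R]_(m, n)) x :
  {for x, continuous f} <-> forall i j, {for x, continuous (fun x => f x i j)}.
Proof. exact: cvg_mxP. Qed.

Lemma continuous_mulmx (X : topologicalType) m n p (f : X -> 'M[R]_(m, n))
    (g : X -> 'M[R]_(n, p)) x :
  {for x, continuous f} -> {for x, continuous g} ->
  {for x, continuous (fun y => f y *m g y)}.
Proof.
move=> /continuous_mxP cf /continuous_mxP cg; apply/continuous_mxP => i j.
rewrite [X in {for x, continuous X}](_ : _ = fun y => \sum_k f y i k * g y k j).
  apply: (cvg_big add_continuous) => k _; apply: cvgM; [exact: cf|exact: cg].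
by apply/funext => y; rewrite mxE.
Qed.

Lemma is_derive_mxP (V : normedModType R) m n (M : V -> 'M[R]_(m, n)) t v dM :
  is_derive t v M dM <-> forall i j, is_derive t v (fun x => M x i j) (dM i j).
Proof.
split=> [[dM1 <-] i j|H].
  rewrite derive_mx // mxE; apply: derivableP.
  by move: dM1 => /derivable_mxP; apply.
have d : derivable M t v by apply/derivable_mxP => i j; have [] := H i j.
split=> //; rewrite derive_mx //; apply/matrixP=> i j; rewrite mxE.
by have [_ ->] := H i j.
Qed.

Lemma is_derive_mulmx (V : normedModType R) m n p (A : V -> 'M[R]_(m, n))
    (B : V -> 'M[R]_(n, p)) t v dA dB :
  is_derive t v A dA -> is_derive t v B dB ->
  is_derive t v (fun x => A x *m B x) (dA *m B t + A t *m dB).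
Proof.
move=> /is_derive_mxP hA /is_derive_mxP hB; apply/is_derive_mxP => i j.
rewrite [X in is_derive _ _ X](_ : _ = \sum_k (fun x => A x i k * B x k j)).
  have h (k : 'I_n) : is_derive t v (fun x => A x i k * B x k j)
      (A t i k *: dB k j + B t k j *: dA i k).
    exact: (@is_deriveM _ _ (fun x => A x i k) (fun x => B x k j)).
  apply: is_derive_eq.
  rewrite !mxE -big_split /=; apply: eq_bigr => k _.
  by rewrite addrC; congr (_ + _); apply: mulrC.
by apply/funext => y; rewrite mxE fct_sumE.
Qed.

Lemma is_derive_mulmxl (V : normedModType R) m n p (C : 'M[R]_(m, n))
    (B : V -> 'M[R]_(n, p)) t v dB :
  is_derive t v B dB -> is_derive t v (fun x => C *m B x) (C *m dB).
Proof.
move=> hB; have := is_derive_mulmx (is_derive_cst C t v) hB.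
by rewrite mul0mx add0r.
Qed.

Lemma is_derive_mulmxr (V : normedModType R) m n p (C : 'M[R]_(n, p))
    (B : V -> 'M[R]_(m, n)) t v dB :
  is_derive t v B dB -> is_derive t v (fun x => B x *m C) (dB *m C).
Proof.
move=> hB; have := is_derive_mulmx hB (is_derive_cst C t v).
by rewrite mulmx0 addr0.
Qed.

Lemma is_derive_derive1 (V : normedModType R) (f : R -> V) (t : R) df :
  is_derive t 1 f df <-> derivable f t 1 /\ derive1 f t = df.
Proof. by rewrite derive1E; split=> [[]|[]]. Qed.

Lemma is_derive_continuous (V : normedModType R) (f : R -> V) (t : R) df :
  is_derive t 1 f df -> {for t, continuous f}.
Proof. by case=> /derivable1_diffP d _; apply: differentiable_continuous. Qed.

Lemma is_derive_comp_curve m n (F : R -> 'M[R]_(m, n)) (s : R -> R) (t : R) ds dF :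
  is_derive t 1 s ds -> is_derive (s t) 1 F dF ->
  is_derive t 1 (fun u => F (s u)) (ds *: dF).
Proof.
move=> hs /is_derive_mxP hF; apply/is_derive_mxP => i j.
have := @is_derive1_comp _ (fun x => F x i j) s t _ _ (hF i j) hs.
by rewrite mxE mulrC.
Qed.

Lemma is_derive0_constant m n (F : R -> 'M[R]_(m, n)) :
  (forall t : R, is_derive t 1 F 0) -> forall t u, F t = F u.
Proof.
move=> h t u; apply/matrixP=> i j.
apply: (@is_derive_0_is_cst _ (fun x => F x i j)) => x.
by have /is_derive_mxP/(_ i j) := h x; rewrite mxE.
Qed.

Lemma is_derive_block_mx (V : normedModType R) m1 m2 n1 n2
    (A : V -> 'M[R]_(m1, n1)) (B : V -> 'M[R]_(m1, n2))
    (C : V -> 'M[R]_(m2, n1)) (D : V -> 'M[R]_(m2, n2)) t v dA dB dC dD :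
  is_derive t v A dA -> is_derive t v B dB -> is_derive t v C dC ->
  is_derive t v D dD ->
  is_derive t v (fun x => block_mx (A x) (B x) (C x) (D x))
    (block_mx dA dB dC dD).
Proof.
move=> /is_derive_mxP hA /is_derive_mxP hB /is_derive_mxP hC /is_derive_mxP hD.
apply/is_derive_mxP => i j.
case: (split_ordP i) => i' ->; case: (split_ordP j) => j' ->.
- rewrite block_mxEul [X in is_derive _ _ X](_ : _ = fun x => A x i' j') //.
  by apply/funext => x; rewrite block_mxEul.
- rewrite block_mxEur [X in is_derive _ _ X](_ : _ = fun x => B x i' j') //.
  by apply/funext => x; rewrite block_mxEur.
- rewrite block_mxEdl [X in is_derive _ _ X](_ : _ = fun x => C x i' j') //.
  by apply/funext => x; rewrite block_mxEdl.
- rewrite block_mxEdr [X in is_derive _ _ X](_ : _ = fun x => D x i' j') //.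
  by apply/funext => x; rewrite block_mxEdr.
Qed.


Lemma is_derive_col_mx (V : normedModType R) m1 m2 n
    (A : V -> 'M[R]_(m1, n)) (B : V -> 'M[R]_(m2, n)) t v dA dB :
  is_derive t v A dA -> is_derive t v B dB ->
  is_derive t v (fun x => col_mx (A x) (B x)) (col_mx dA dB).
Proof.
move=> /is_derive_mxP hA /is_derive_mxP hB; apply/is_derive_mxP => i j.
case: (split_ordP i) => i' ->.
- rewrite col_mxEu [X in is_derive _ _ X](_ : _ = fun x => A x i' j) //.
  by apply/funext => x; rewrite col_mxEu.
- rewrite col_mxEd [X in is_derive _ _ X](_ : _ = fun x => B x i' j) //.
  by apply/funext => x; rewrite col_mxEd.
Qed.

Lemma derivable_sum_seq (V : normedModType R) I (r : seq I) (f : I -> V -> R) t v :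
  (forall i, derivable (f i) t v) -> derivable (fun x => \sum_(i <- r) f i x) t v.
Proof.
move=> h; elim: r => [|i r IH].
  rewrite [X in derivable X](_ : _ = cst 0); first exact: derivable_cst.
  by apply/funext => x; rewrite big_nil.
rewrite [X in derivable X](_ : _ = f i + (fun x => \sum_(i <- r) f i x)).
  exact: derivableD.
by apply/funext => x; rewrite big_cons.
Qed.

Lemma derivable_prod_seq (V : normedModType R) I (r : seq I) (f : I -> V -> R) t v :
  (forall i, derivable (f i) t v) -> derivable (fun x => \prod_(i <- r) f i x) t v.
Proof.
move=> h; elim: r => [|i r IH].
  rewrite [X in derivable X](_ : _ = cst 1); first exact: derivable_cst.
  by apply/funext => x; rewrite big_nil.
rewrite [X in derivable X](_ : _ = f i * (fun x => \prod_(i <- r) f i x)).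
  exact: derivableM.
by apply/funext => x; rewrite big_cons.
Qed.

Lemma derivable_det (V : normedModType R) n (M : V -> 'M[R]_n) t v :
  derivable M t v -> derivable (fun x => \det (M x)) t v.
Proof.
move=> /derivable_mxP h; apply: derivable_sum_seq => s.
rewrite [X in derivable X](_ : _ = (-1) ^+ s *: (fun x => \prod_i M x i (s i))) //.
by apply: derivableZ; apply: derivable_prod_seq.
Qed.

(** Derivability comes from the cofactor formula; the value then follows by differentiating
    [Phi Phi^-1 = 1]. *)
Lemma is_derive_invmx n (Phi dPhi : R -> 'M[R]_n) :
  (forall t, Phi t \in unitmx) -> (forall t : R, is_derive t 1 Phi (dPhi t)) ->
  forall t : R, is_derive t 1 (fun x => invmx (Phi x))
    (- (invmx (Phi t) *m dPhi t *m invmx (Phi t))).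
Proof.
move=> uPhi hPhi t.
have d : derivable (fun x => invmx (Phi x)) t 1.
  rewrite [X in derivable X](_ : _ = fun x => (\det (Phi x))^-1 *: \adj (Phi x)).
    apply/derivable_mxP => i j.
    rewrite [X in derivable X](_ : _ =
        (fun x => (\det (Phi x))^-1) * (fun x => cofactor (Phi x) j i)); last first.
      by apply/funext => x; rewrite !mxE.
    apply: derivableM.
      apply: derivableV; first by have := uPhi t; rewrite unitmxE unitfE.
      by apply: derivable_det; have [] := hPhi t.
    rewrite /cofactor [X in derivable X](_ : _ =
       (-1) ^+ (j + i) *: (fun x => \det (row' j (col' i (Phi x))))) //.
    apply: derivableZ; apply: derivable_det; apply/derivable_mxP => k l.
    have [/derivable_mxP h _] := hPhi t.
    rewrite [X in derivable X](_ : _ = fun x => Phi x (lift j k) (lift i l)) //.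
    by apply/funext => x; rewrite !mxE.
  by apply/funext => x; rewrite /invmx uPhi.
have h := is_derive_mulmx (hPhi t) (derivableP d).
have h0 : is_derive t 1 (fun x => Phi x *m invmx (Phi x)) 0.
  rewrite (_ : (fun x => _) = cst 1%:M); first exact: is_derive_cst.
  by apply/funext => x; rewrite mulmxV.
have E : dPhi t *m invmx (Phi t) + Phi t *m 'D_1 (fun x => invmx (Phi x)) t = 0.
  by case: h => _ <-; case: h0.
split=> //; apply: (can_inj (mulKmx (uPhi t))).
rewrite mulmxN !mulmxA mulmxV // mul1mx.
by apply/eqP; rewrite -subr_eq0 opprK addrC E.
Qed.

(** [E t] plays the role of [exp (t H)], so [T H] is a logarithm of [K]. Commutation is part of the
    data because it makes [E (- t) *m E t] have derivative 0. *)
Definition real_log T m (H K : 'M[R]_m) := exists E : R -> 'M[R]_m,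
  [/\ E 0 = 1%:M, E T = K, forall t : R, is_derive t 1 E (H *m E t) &
      forall t, H *m E t = E t *m H].

Lemma real_log_dsum T m n (H K : 'M[R]_m) (H' K' : 'M[R]_n) :
  real_log T H K -> real_log T H' K' -> real_log T (dsum H H') (dsum K K').
Proof.
move=> [E [E0 ET dE cE]] [E' [E0' ET' dE' cE']].
exists (fun t => dsum (E t) (E' t)); split.
- by rewrite E0 E0' -scalar_mx_block.
- by rewrite ET ET'.
- move=> t; rewrite mul_dsum.
  by apply: is_derive_block_mx => //; apply: is_derive_cst.
- by move=> t; rewrite !mul_dsum cE cE'.
Qed.

Lemma real_log_mx0 T (H K : 'M[R]_0) : real_log T H K.
Proof.
exists (fun _ => 0); split; [by rewrite [1%:M]flatmx0|by rewrite [K]flatmx0| |].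
  by move=> t; rewrite [X in is_derive _ _ _ X]flatmx0; apply: is_derive_cst.
by move=> t; rewrite mulmx0 mul0mx.
Qed.

Section Flow.
Variables (m : nat) (H : 'M[R]_m) (E : R -> 'M[R]_m).
Hypothesis E0 : E 0 = 1%:M.
Hypothesis dE : forall t : R, is_derive t 1 E (H *m E t).
Hypothesis cE : forall t, H *m E t = E t *m H.

Lemma is_derive_flowN (t : R) : is_derive t 1 (fun t => E (- t)) (- (H *m E (- t))).
Proof.
by have := is_derive_comp_curve (is_deriveNid t 1) (dE (- t)); rewrite scaleN1r.
Qed.

Lemma flowNK t : E (- t) *m E t = 1%:M.
Proof.
have h (u : R) : is_derive u 1 (fun t => E (- t) *m E t) 0.
  have := is_derive_mulmx (is_derive_flowN u) (dE u).
  by rewrite mulmxA -cE mulNmx addNr.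
by rewrite (is_derive0_constant h t 0) oppr0 E0 mulmx1.
Qed.

Lemma flowKN t : E t *m E (- t) = 1%:M.
Proof. by have := flowNK (- t); rewrite opprK. Qed.

Lemma flowD t u : E (t + u) = E t *m E u.
Proof.
have h (x : R) : is_derive x 1 (fun t => E (- t) *m E (t + u)) 0.
  have hs : is_derive x 1 (fun t : R => E (t + u)) (H *m E (x + u)).
    have := is_derive_comp_curve (is_derive_shift x 1 u) (dE (x + u)).
    by rewrite scale1r.
  have := is_derive_mulmx (is_derive_flowN x) hs.
  by rewrite mulmxA -cE mulNmx addNr.
have := is_derive0_constant h t 0; rewrite oppr0 E0 mul1mx add0r => /(congr1 (mulmx (E t))).
by rewrite mulmxA flowKN mul1mx.
Qed.

Lemma flow_comm (S : 'M[R]_m) t : S *m H = H *m S -> S *m E t = E t *m S.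
Proof.
move=> SH; have h (u : R) : is_derive u 1 (fun t => E (- t) *m (S *m E t)) 0.
  have := is_derive_mulmx (is_derive_flowN u) (is_derive_mulmxl S (dE u)).
  by rewrite cE mulNmx !mulmxA -(mulmxA _ H S) -SH mulmxA addNr.
have := is_derive0_constant h t 0; rewrite oppr0 E0 mul1mx mulmx1.
by move=> /(congr1 (mulmx (E t))); rewrite mulmxA flowKN mul1mx.
Qed.

End Flow.

End MatrixCalculus.

(** * Real logarithms *)

Section RealLog.
Variable R : realType.
Implicit Types (T a b t : R) (k : nat).

(** The exponential of [t] times the nilpotent block; the series terminates. *)
Definition exp_shift k t : 'M[R]_k :=
  \matrix_(i, j) if (i <= j)%N then t ^+ (j - i) / ((j - i)`!)%:R else 0.

Lemma exp_shift0 k : exp_shift k 0 = 1%:M.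
Proof.
apply/matrixP => i j; rewrite !mxE; case: leqP => ij; last first.
  by rewrite -val_eqE /= gtn_eqF.
case: (eqVneq i j) => [->|ne]; first by rewrite subnn expr0 fact0 divr1.
have nij : (j - i)%N != 0%N by move: ne; rewrite -val_eqE /=; lia.
by rewrite expr0n (negPf nij) mul0r.
Qed.

Lemma exp_shift_comm k t :
  shift_mx R k 1 *m exp_shift k t = exp_shift k t *m shift_mx R k 1.
Proof.
apply/matrixP => i j; rewrite mul_shift_mx mul_mx_shift.
case: insubP => [i' _ Ei'|Hi]; case: ifP => j1; try (case: insubP => [j' _ Ej'|Hj]);
  rewrite ?mxE ?Ei' ?Ej' //; have := ltn_ord j; have := ltn_ord i.
- move=> _ _; rewrite (_ : (i + 1 <= j)%N = (i <= j - 1)%N); last by lia.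
  by rewrite (_ : (j - (i + 1) = j - 1 - i)%N); last lia.
- by move: Hj; lia.
- by move=> _ _; case: leqP => //; lia.
- by move=> li lj; case: leqP => //; lia.
Qed.

Lemma is_derive_exp_shift k t :
  is_derive t 1 (exp_shift k) (shift_mx R k 1 *m exp_shift k t).
Proof.
apply/is_derive_mxP => i j.
rewrite mul_shift_mx.
case: (leqP i j) => ij; last first.
  rewrite [X in is_derive _ _ X](_ : _ = cst 0); last first.
    by apply/funext => x; rewrite mxE leqNgt ij.
  apply: is_derive_eq.
  case: insubP => [i' _ Ei'|//]; rewrite mxE Ei'; case: leqP => //; lia.
set n := (j - i)%N.
rewrite [X in is_derive _ _ X](_ : _ = (n`!%:R)^-1 *: (fun x => x ^+ n)); last first.
  by apply/funext => x; rewrite mxE ij /= mulrC.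
have hX : is_derive t 1 (fun x : R => x ^+ n) (n%:R *: t ^+ n.-1 *: 1).
  by split; [exact: exprn_derivable|exact: exp_derive].
apply: is_derive_eq.
case E: n => [|q].
  rewrite !scale0r scaler0.
  by case: insubP => [i' _ Ei'|//]; rewrite mxE Ei'; case: leqP => //; lia.
case: insubP => [i' _ Ei'|]; last by have := ltn_ord j; lia.
rewrite mxE Ei'; have -> : (i + 1 <= j)%N by lia.
have -> : (j - (i + 1) = q)%N by lia.
rewrite factS natrM invfM /GRing.scale /= mulr1 mulrACA.
by rewrite mulVf ?mul1r ?pnatr_eq0 // mulrC.
Qed.


(** After subtraction of [l] the matrix is strictly upper triangular with superdiagonal entries
    [l T], all nonzero. Working with this representative instead of the Jordan block itself keeps
    the logarithm explicit. *)
Lemma similar_exp_shift k (f : {rmorphism R -> R[i]}) T (l : R[i]) :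
  0 < T -> l != 0 ->
  similar_mx (l *: map_mx f (exp_shift k T)) (jordan_block (l, k)).
Proof.
move=> T0 l0; rewrite /jordan_block [_ + shift_mx _ _ _]addrC /=.
set M := l *: _; rewrite -[M](subrK l%:M).
apply: similar_addscalar; apply: similar_strict_upper => i j; rewrite !mxE.
  rewrite leq_eqVlt => /predU1P[/val_inj ->|ji].
    by rewrite leqnn subnn expr0 fact0 divr1 rmorph1 eqxx mulr1 subrr.
  by rewrite leqNgt ji /= rmorph0 mulr0 -val_eqE /= gtn_eqF // subr0.
move=> ji; rewrite -val_eqE /= ji leqnSn subSnn expr1 factS fact0 divr1.
rewrite (_ : (i == i.+1 :> nat) = false); last by lia.
by rewrite subr0 mulf_neq0 // fmorph_eq0 gt_eqF.
Qed.

Lemma is_derive_scaled_exp_shift k (c : R -> R) dc t :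
  is_derive t 1 c dc ->
  is_derive t 1 (fun t => c t *: exp_shift k t)
    (dc *: exp_shift k t + c t *: (shift_mx R k 1 *m exp_shift k t)).
Proof.
move=> hc; have hs := is_derive_exp_shift k t.
have := is_derive_mulmx (A := fun t => (c t)%:M) (dA := dc%:M) _ hs.
rewrite !mul_scalar_mx.
have -> : (fun t => c t *: exp_shift k t) = (fun t => (c t)%:M *m exp_shift k t).
  by apply/funext => x; rewrite mul_scalar_mx.
apply; apply/is_derive_mxP => i j; rewrite mxE.
rewrite [X in is_derive _ _ X](_ : _ = (i == j)%:R *: c).
  by apply: is_derive_eq; rewrite /GRing.scale /= mulr_natl.
by apply/funext => x; rewrite mxE [RHS]mulr_natl.
Qed.

Lemma real_log_pos T a k : 0 < T -> 0 < a ->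
  real_log T (jordan_block (ln a / T, k)) (a *: exp_shift k T).
Proof.
move=> T0 a0; pose c t := expR (ln a / T * t).
exists (fun t => c t *: exp_shift k t); split.
- by rewrite /c mulr0 expR0 scale1r exp_shift0.
- by rewrite /c divfK ?gt_eqF // lnK.
- move=> t.
  have hc : is_derive t 1 c (ln a / T * c t).
    rewrite /c; have hl : is_derive t 1 (fun t => ln a / T * t) (ln a / T).
      have := is_deriveZ (ln a / T) (is_derive_id t 1).
      by rewrite /GRing.scale /= mulr1.
    have h := is_derive1_comp (is_derive_expR _) hl.
    by apply: (is_derive_eq h); apply: mulrC.
  have := is_derive_scaled_exp_shift k hc.
  by rewrite /jordan_block /= mulmxDl mul_scalar_mx scalerA -scalemxAr.
- move=> t; rewrite /jordan_block /= mulmxDl mulmxDr mul_scalar_mx mul_mx_scalar.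
  by rewrite -scalemxAr -scalemxAl exp_shift_comm.
Qed.

(** The real form of the complex matrix [A + i B]. *)
Definition rotation_mx k (A B : 'M[R]_k) : 'M[R]_(k + k) := block_mx A (- B) B A.

Lemma mul_rotation_mx k (A B C D : 'M[R]_k) :
  rotation_mx A B *m rotation_mx C D =
  rotation_mx (A *m C - B *m D) (A *m D + B *m C).
Proof.
rewrite /rotation_mx mulmx_block !mulmxN !mulNmx opprD; congr block_mx.
- by rewrite addrC.
- by rewrite addrC.
Qed.

Lemma exists_angle (x y : R) : x ^+ 2 + y ^+ 2 = 1 ->
  exists u : R, cos u = x /\ sin u = y.
Proof.
move=> xy; have x1 : -1 <= x <= 1.
  by rewrite -ler_norml -(@expr_le1 _ 2) // real_normK ?num_real //; nra.
have yE : `|y| = sin (acos x).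
  rewrite sin_acos // -sqrtr_sqr; congr Num.sqrt; lra.
(* [acos x] determines the sine only up to sign, so the sign of [y] selects the angle. *)
case: (lerP 0 y) => y0.
  by exists (acos x); rewrite acosK // -yE ger0_norm.
by exists (- acos x); rewrite cosN sinN acosK // -yE ltr0_norm // opprK.
Qed.

(** The curve is the real form of [exp (t (ln a + i u) / T)] times the unipotent factor; [c] and [s]
    are the real and imaginary parts of the scalar factor. *)
Lemma real_log_rotation T a u k : 0 < T -> 0 < a ->
  real_log T (rotation_mx (jordan_block (ln a / T, k)) (u / T)%:M)
    (rotation_mx ((a * cos u) *: exp_shift k T) ((a * sin u) *: exp_shift k T)).
Proof.
move=> T0 a0; pose e t := expR (ln a / T * t).
pose c t := e t * cos (u / T * t); pose s t := e t * sin (u / T * t).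
have hl w t : is_derive t 1 (fun t => w * t) w.
  by have := is_deriveZ w (is_derive_id t 1); rewrite /GRing.scale /= mulr1.
have he t : is_derive t 1 e (ln a / T * e t).
  have h := is_derive1_comp (is_derive_expR _) (hl (ln a / T) t).
  by apply: (is_derive_eq h); apply: mulrC.
have hc t : is_derive t 1 c (ln a / T * c t - u / T * s t).
  have h := is_derive1_comp (is_derive_cos _) (hl (u / T) t).
  apply: (is_derive_eq (is_deriveM (he t) h)).
  rewrite /c /s /GRing.scale /=; ring.
have hs t : is_derive t 1 s (ln a / T * s t + u / T * c t).
  have h := is_derive1_comp (is_derive_sin _) (hl (u / T) t).
  apply: (is_derive_eq (is_deriveM (he t) h)).
  rewrite /c /s /GRing.scale /=; ring.
exists (fun t => rotation_mx (c t *: exp_shift k t) (s t *: exp_shift k t)); split.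
- rewrite /c /s /e !mulr0 expR0 cos0 sin0 mulr0 mulr1 scale0r scale1r exp_shift0.
  by rewrite /rotation_mx oppr0 -scalar_mx_block.
- by rewrite /c /s /e !divfK ?gt_eqF // lnK.
- move=> t.
  have dc := is_derive_scaled_exp_shift k (hc t).
  have ds := is_derive_scaled_exp_shift k (hs t).
  have dsN := is_deriveN ds.
  rewrite mul_rotation_mx /jordan_block /= !mulmxDl !mul_scalar_mx !scalerA.
  rewrite -!scalemxAr.
  have -> : (ln a / T * c t) *: exp_shift k t + c t *: (shift_mx R k 1 *m exp_shift k t) -
     (u / T * s t) *: exp_shift k t = (ln a / T * c t - u / T * s t) *: exp_shift k t +
     c t *: (shift_mx R k 1 *m exp_shift k t).
    by rewrite scalerBl addrAC.
  have -> : (ln a / T * s t) *: exp_shift k t + s t *: (shift_mx R k 1 *m exp_shift k t) +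
     (u / T * c t) *: exp_shift k t = (ln a / T * s t + u / T * c t) *: exp_shift k t +
     s t *: (shift_mx R k 1 *m exp_shift k t).
    by rewrite scalerDl addrAC.
  exact: is_derive_block_mx.
- move=> t; rewrite !mul_rotation_mx; congr rotation_mx.
    rewrite /jordan_block /= !mulmxDl !mulmxDr !mul_scalar_mx !mul_mx_scalar.
    by rewrite -!scalemxAr -!scalemxAl exp_shift_comm.
  rewrite /jordan_block /= !mulmxDl !mulmxDr !mul_scalar_mx !mul_mx_scalar.
  by rewrite -!scalemxAr -!scalemxAl exp_shift_comm [RHS]addrC.
Qed.

End RealLog.

(** * Real normal form of the monodromy matrix *)

Section RealJordan.
Variable R : realType.
Implicit Types (T : R) (l : R[i]) (bs : seq (R[i] * nat)).
Local Notation rc := (real_complex R).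

Lemma cplx_mxE m n (M : 'M[R]_(m, n)) : cplx_mx M = map_mx rc M.
Proof. by []. Qed.

Lemma cplx_mx_Re_Im m n (P : 'M[R[i]]_(m, n)) :
  P = cplx_mx (map_mx (@complex.Re R) P) + 'i%C *: cplx_mx (map_mx (@complex.Im R) P).
Proof. by apply/matrixP => i j; rewrite !mxE; apply: complexE. Qed.

Lemma cplx_mx_ReD_inj m n (A B C D : 'M[R]_(m, n)) :
  cplx_mx A + 'i%C *: cplx_mx B = cplx_mx C + 'i%C *: cplx_mx D -> A = C /\ B = D.
Proof.
move=> E; split; apply/matrixP => i j; move/matrixP: E => /(_ i j); rewrite !mxE;
  by move=> /eqP; rewrite eq_complex /= !(mul0r, mul1r, mulr0, subr0, addr0, add0r) => /andP[/eqP ? /eqP ?].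
Qed.

(* If P = P1 + i P2 intertwines two real matrices then so does P1 + x P2 for
   every real x; det (P1 + x P2) is a polynomial in x that is nonzero at x = i. *)
Lemma similar_cplx_mx n (A B : 'M[R]_n) :
  similar_mx (cplx_mx A) (cplx_mx B) -> similar_mx A B.
Proof.
move=> /similar_unitmxP[P uP AP].
set P1 := map_mx (@complex.Re R) P; set P2 := map_mx (@complex.Im R) P.
have PE : P = cplx_mx P1 + 'i%C *: cplx_mx P2 by exact: cplx_mx_Re_Im.
have [A1 A2] : A *m P1 = P1 *m B /\ A *m P2 = P2 *m B.
  apply: cplx_mx_ReD_inj; move: AP; rewrite PE mulmxDr mulmxDl -scalemxAr -scalemxAl.
  by rewrite !cplx_mxE !map_mxM.
pose p : {poly R} := \det (map_mx polyC P1 + 'X *: map_mx polyC P2).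
have p0 : p != 0.
  apply/eqP => p0.
  have : (map_poly rc p).['i%C] = \det P.
    rewrite -horner_evalE -!det_map_mx; congr (\det _).
    apply/matrixP => i j; rewrite !mxE.
    rewrite !rmorphD !rmorphM /= map_polyX !map_polyC /=.
    rewrite /horner_eval hornerX !hornerC.
    by apply/esym/complexE.
  rewrite p0 rmorph0 horner0 => /esym E.
  by move: uP; rewrite unitmxE E unitr0.
(* A nonzero polynomial has fewer roots than its size, so one of the first [size p] naturals is not
   a root. *)
have [x px] : exists x : R, ~~ root p x.
  have /allPn[x _ px] : ~~ all (root p) [seq i%:R | i <- iota 0 (size p)].
    apply/negP => al; have := max_poly_roots p0 al.
    rewrite size_map size_iota ltnn map_inj_uniq ?iota_uniq; first by move/(_ isT).
    by move=> a b /eqP; rewrite eqr_nat => /eqP.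
  by exists x.
apply: (@similar_unitmx _ _ _ _ (P1 + x *: P2)).
  move: px; rewrite unitmxE unitfE /root -horner_evalE -det_map_mx.
  rewrite (_ : map_mx _ _ = P1 + x *: P2) //.
  by apply/matrixP => i j; rewrite !mxE /= /horner_eval !hornerE.
by rewrite mulmxDr mulmxDl -scalemxAr -scalemxAl A1 A2.
Qed.

(** The block columns [(1, - i)] and [(1, i)] span the invariant subspaces on which the matrix acts
    as [A + i B] and [A - i B]. *)
Lemma similar_rotation_mx k (A B : 'M[R]_k) :
  similar_mx (cplx_mx (rotation_mx A B))
    (dsum (cplx_mx A + 'i%C *: cplx_mx B) (cplx_mx A - 'i%C *: cplx_mx B)).
Proof.
have ii : 'i%C * 'i%C = -1 :> R[i] by exact: sqr_i.
have mulS (a b c d a' b' c' d' : R[i]) :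
    block_mx a%:M b%:M c%:M d%:M *m block_mx a'%:M b'%:M c'%:M d'%:M =
    block_mx (a * a' + b * c')%:M (a * b' + b * d')%:M
      (c * a' + d * c')%:M (c * b' + d * d')%:M :> 'M[R[i]]_(k + k).
  by rewrite mulmx_block -!scalar_mxM -!raddfD.
have two : 2 * 2^-1 = 1 :> R[i] by rewrite mulfV // pnatr_eq0.
have two' : 2^-1 + 2^-1 = 1 :> R[i] by rewrite -mulr2n -[LHS]mulr_natl.
exists (block_mx 1%:M 1%:M (- 'i%C)%:M ('i%C)%:M).
exists (block_mx (2^-1)%:M (2^-1 * 'i%C)%:M (2^-1)%:M (- (2^-1 * 'i%C))%:M).
have e : 'i%C * (2^-1 * 'i%C) = - 2^-1 :> R[i] by rewrite mulrCA ii mulrN1.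
split.
- rewrite mulS !mul1r two' subrr mulNr addNr mulrN mulNr e !opprK two'.
  by rewrite raddf0 -scalar_mx_block.
- rewrite mulS !mulr1 !mulrN !mulNr -!mulrA ii !mulrN1 !opprK two' !subrr.
  by rewrite raddf0 -scalar_mx_block.
rewrite cplx_mxE map_block_mx /= -!cplx_mxE mulmx_block.
rewrite [RHS]mulmx_block !mulmx0 !mul1mx !mulmx1 !add0r !addr0 !mul_mx_scalar !mul_scalar_mx.
rewrite !scalerDr !scalerN !scalerA !mulNr ii !scaleNr scale1r !opprK.
rewrite (_ : cplx_mx (- B) = - cplx_mx B); last by rewrite !cplx_mxE map_mxN.
by rewrite !scalerN !opprK; congr block_mx; rewrite addrC.
Qed.

Lemma jordan_mx_entry bs i j : jordan_mx bs i j = jordan_entry bs i j.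
Proof.
elim: bs i j => [[]//|[a k] bs IH] i j /=.
case: (split_ordP i) => i' ->; case: (split_ordP j) => j' ->.
- rewrite block_mxEul !mxE /= -val_eqE /= addn1.
  case: eqP => [->|_]; last by rewrite mulr0n add0r; case: eqP.
  by case: eqP => [|_]; [lia|rewrite mulr1n addr0].
- by rewrite block_mxEur mxE.
- by rewrite block_mxEdl mxE.
- by rewrite block_mxEdr /= !addKn IH.
Qed.

Lemma jordan_form_similar n (M : 'M[R[i]]_n) bs :
  jordan_form M bs -> similar_mx M (jordan_mx bs).
Proof.
move=> [_ e [P [uP MP]]]; subst n.
apply: (@similar_unitmx _ _ _ _ P) => //.
have -> : jordan_mx bs = invmx P *m M *m P.
  by apply/matrixP => i j; rewrite MP jordan_mx_entry.
by rewrite !mulmxA mulmxV // mul1mx.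
Qed.

(** Conjugation fixes [cplx_mx M] and preserves ranks, so the rank sequences at [l] and at its
    conjugate agree, and with them their second differences. Size 0 lies outside the counting
    formula and is excluded by positivity. *)
Lemma count_jordan_conj n (M : 'M[R]_n) bs b :
  (forall b, b \in bs -> (0 < b.2)%N) ->
  similar_mx (cplx_mx M) (jordan_mx bs) ->
  count_mem b bs = count_mem (b.1^*%C, b.2) bs.
Proof.
move=> pos sM; case: b => l [|k] /=.
  have c0 a : count_mem (a, 0%N) bs = 0%N.
    by apply/count_memPn/negP => /pos.
  by rewrite !c0.
have E j : jordan_rank bs l j = jordan_rank bs l^*%C j.
  rewrite -!rank_jordan_mx_exp.
  have r a : similar_mx ((cplx_mx M - a%:M) ^+ j) ((jordan_mx bs - a%:M) ^+ j).
    by apply: similar_exp; rewrite -!raddfN; apply: similar_addscalar.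
  rewrite -(similar_rank (r _)) -(similar_rank (r _)).
  rewrite -(mxrank_map (@conjc R)) rmorphXn /= map_mxB map_scalar_mx; congr (\rank ((_ - _) ^+ _)).
  by apply/matrixP => a c; rewrite !mxE; apply/eqP; rewrite eq_complex /= oppr0 !eqxx.
have := count_jordan_rank bs l k; rewrite !E count_jordan_rank.
by move=> /addnI.
Qed.

Lemma similar_dsum0 (F : fieldType) n (A : 'M[F]_0) (B : 'M[F]_n) :
  similar_mx (dsum A B) B.
Proof.
exists (col_mx 0 1%:M), (row_mx 0 1%:M); split.
- rewrite mul_col_row !mul0mx mulmx0 mulmx1 [RHS](scalar_mx_block 0 n 1).
  by congr block_mx; rewrite [RHS]flatmx0.
- by rewrite mul_row_col mul0mx add0r mulmx1.
- by rewrite mul_block_col mul_col_mx !mul0mx !mulmx0 !addr0 add0r mulmx1 mul1mx.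
Qed.

Lemma similar_jordan_mx_cat (F : fieldType) (b1 b2 : seq (F * nat)) :
  similar_mx (jordan_mx (b1 ++ b2)) (dsum (jordan_mx b1) (jordan_mx b2)).
Proof.
elim: b1 => [|b b1 IH]; first exact/similar_sym/similar_dsum0.
apply: similar_trans (similar_dsum (similar_refl _) IH) _.
exact: similar_dsumA.
Qed.

(** Summing over a larger duplicate-free list lets the A-indices of two block lists be compared term
    by term. *)
Lemma A_index_subset u bs : uniq u -> {subset bs <= u} ->
  A_index_of_jordan bs =
  (\sum_(b <- u | neg_real b.1 && odd (count_mem b bs)) b.2)%N.
Proof.
move=> uu su; rewrite /A_index_of_jordan.
have pe : perm_eq (undup bs) [seq b <- u | b \in bs].
  apply: uniq_perm; rewrite ?undup_uniq ?filter_uniq // => b.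
  by rewrite mem_undup mem_filter; case: (boolP (b \in bs)) => // /su ->.
rewrite (perm_big _ pe) big_filter_cond; apply: eq_bigl => b.
case: (boolP (b \in bs)) => //= /count_memPn ->.
by rewrite andbF.
Qed.

Lemma A_index_perm bs1 bs2 : perm_eq bs1 bs2 ->
  A_index_of_jordan bs1 = A_index_of_jordan bs2.
Proof.
move=> pe; rewrite (@A_index_subset (undup bs2) bs1) ?undup_uniq //.
  by apply: eq_bigl => b; rewrite (seq.permP pe).
by move=> b; rewrite mem_undup (perm_mem pe).
Qed.

Lemma A_index_cons b bs : ~~ neg_real b.1 ->
  A_index_of_jordan (b :: bs) = A_index_of_jordan bs.
Proof.
move=> nb; rewrite !(@A_index_subset (undup (b :: bs))) ?undup_uniq //.
- apply: eq_bigl => c; case nc: (neg_real c.1) => //=.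
  by case: eqP nb => [->|]; rewrite ?nc.
- by move=> c cbs; rewrite mem_undup inE cbs orbT.
- by move=> c; rewrite mem_undup.
Qed.

Lemma A_index_cons2 b bs :
  A_index_of_jordan [:: b, b & bs] = A_index_of_jordan bs.
Proof.
rewrite !(@A_index_subset (undup (b :: bs))) ?undup_uniq //.
- by apply: eq_bigl => c /=; rewrite addnA addnn oddD odd_double.
- by move=> c cbs; rewrite mem_undup inE cbs orbT.
- by move=> c; rewrite mem_undup !inE orbA orbb.
Qed.

Lemma A_index_cons_neg b bs : neg_real b.1 -> b \notin bs ->
  A_index_of_jordan (b :: bs) = (b.2 + A_index_of_jordan bs)%N.
Proof.
move=> nb bbs; rewrite /A_index_of_jordan /= (negPf bbs) big_cons eqxx nb.
rewrite (count_memPn bbs) /=; congr addn.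
rewrite big_seq_cond [RHS]big_seq_cond; apply: eq_bigl => c.
rewrite mem_undup; case: (boolP (c \in bs)) => //= cbs.
by case: eqP => [bc|//]; move: bbs; rewrite bc cbs.
Qed.

Lemma cplx_jordan_block (a : R) k :
  cplx_mx (jordan_block (a, k)) = jordan_block (rc a, k).
Proof.
apply/matrixP => i j; rewrite !mxE [LHS](rmorphD rc) /=.
by rewrite rmorphMn rmorph_nat.
Qed.

Definition cmod_exponents T (ls : seq R[i]) := [seq ln (cmod l) / T | l <- ls].

(** Only real parts are recorded: the angle chosen for a logarithm affects imaginary parts alone. *)
Definition has_exponents m (H : 'M[R]_m) (es : seq R) := exists rs : seq R[i],
  eigenvalues_mult H rs /\ perm_eq [seq complex.Re r | r <- rs] es.

Lemma has_exponents_dsum m n (H : 'M[R]_m) (H' : 'M[R]_n) es es' :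
  has_exponents H es -> has_exponents H' es' ->
  has_exponents (dsum H H') (es ++ es').
Proof.
move=> [rs [ers prs]] [rs' [ers' prs']]; exists (rs ++ rs'); split.
  rewrite /eigenvalues_mult cplx_mxE map_block_mx !map_mx0 char_poly_dsum.
  by rewrite -!cplx_mxE ers ers' big_cat.
by rewrite map_cat perm_cat.
Qed.

Lemma has_exponents_perm m (H : 'M[R]_m) es es' :
  perm_eq es es' -> has_exponents H es -> has_exponents H es'.
Proof. by move=> pe [rs [ers prs]]; exists rs; split=> //; apply: perm_trans pe. Qed.

Lemma has_exponents_jordan_block (a : R) k :
  has_exponents (jordan_block (a, k)) (nseq k a).
Proof.
exists (nseq k (rc a)); split; last by rewrite map_nseq.
rewrite /eigenvalues_mult cplx_jordan_block (char_poly_jordan_block (rc a, k)) /=.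
by rewrite big_nseq -Monoid.iteropE.
Qed.

Lemma has_exponents_rotation (a b : R) k :
  has_exponents (rotation_mx (jordan_block (a, k)) b%:M) (nseq k a ++ nseq k a).
Proof.
pose l := Complex a b.
exists (nseq k l ++ nseq k l^*%C); split; last by rewrite map_cat !map_nseq.
rewrite /eigenvalues_mult (similar_char_poly (similar_rotation_mx _ _)) char_poly_dsum.
have E (c : R) : cplx_mx (jordan_block (a, k)) + 'i%C *: cplx_mx c%:M =
    jordan_block (Complex a c, k).
  rewrite cplx_jordan_block /jordan_block /= addrAC; congr (_ + _).
  rewrite cplx_mxE map_scalar_mx scale_scalar_mx -raddfD; congr _%:M.
  exact/esym/complexE.
rewrite E (_ : _ - _ = jordan_block (l^*%C, k)); last first.
  by rewrite -[RHS](E (- b)) !cplx_mxE !map_scalar_mx /= rmorphN raddfN /= scalerN.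
rewrite (char_poly_jordan_block (l, k)) (char_poly_jordan_block (l^*%C, k)).
by rewrite big_cat !big_nseq -!Monoid.iteropE.
Qed.

Lemma cmod_gt0 l : l != 0 -> 0 < cmod l.
Proof.
case: l => x y; rewrite eq_complex /= negb_and => xy.
by rewrite /cmod sqrtr_gt0 lt_def paddr_eq0 ?sqr_ge0 // !sqrf_eq0 negb_and xy addr_ge0 ?sqr_ge0.
Qed.

Lemma cmod_conj l : cmod l^*%C = cmod l.
Proof. by case: l => x y; rewrite /cmod /= sqrrN. Qed.

Lemma cmod_real (x : R) : cmod (Complex x 0) = `|x|.
Proof. by rewrite /cmod /= expr0n addr0 sqrtr_sqr. Qed.

(** The pair is realized by rotation through an argument [u] of [l]. Since [l] may be real, the same
    lemma covers two equal negative blocks. *)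
Lemma real_log_conj_pair T l k : 0 < T -> l != 0 ->
  exists H K : 'M[R]_(k + k),
    [/\ real_log T H K,
        similar_mx (cplx_mx K) (dsum (jordan_block (l, k)) (jordan_block (l^*%C, k))) &
        has_exponents H (cmod_exponents T (nseq k l ++ nseq k l^*%C))].
Proof.
move=> T0 l0; have a0 := cmod_gt0 l0; set a := cmod l in a0.
have [u [cu su]] : exists u : R, cos u = complex.Re l / a /\ sin u = complex.Im l / a.
  apply: exists_angle; rewrite !expr_div_n -mulrDl.
  by rewrite /a /cmod sqr_sqrtr ?addr_ge0 ?sqr_ge0 // divff // gt_eqF // -sqrtr_gt0.
exists (rotation_mx (jordan_block (ln a / T, k)) (u / T)%:M).
exists (rotation_mx ((a * cos u) *: exp_shift k T) ((a * sin u) *: exp_shift k T)).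
split.
- exact: real_log_rotation.
- apply: similar_trans (similar_rotation_mx _ _) _.
  rewrite cu su ![a * _]mulrC !divfK ?gt_eqF // !cplx_mxE !map_mxZ.
  rewrite !scalerA -scalerDl -scalerBl.
  rewrite (_ : _ + _ = l); last by rewrite [RHS]complexE.
  rewrite (_ : _ - _ = l^*%C); last first.
    by rewrite [RHS]complexE; case: (l) => x y /=; rewrite rmorphN mulrN.
  by apply: similar_dsum; apply: similar_exp_shift; rewrite ?conjc_eq0.
- rewrite /cmod_exponents map_cat !map_nseq cmod_conj.
  exact: has_exponents_rotation.
Qed.

Definition jordan_eigenvalues bs := flatten [seq nseq b.2 b.1 | b <- bs].

(** The induction invariant: [K2] collects the negatives of the unpaired negative blocks, so its
    size is the A-index, and everything else goes into [K1]. *)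
Definition real_normal_form T bs := exists p d (H1 K1 : 'M[R]_p) (H2 K2 : 'M[R]_d),
  [/\ d = A_index_of_jordan bs, real_log T H1 K1, real_log T H2 K2,
      similar_mx (jordan_mx bs) (cplx_mx (dsum K1 (- K2))) &
      has_exponents (dsum H1 H2) (cmod_exponents T (jordan_eigenvalues bs))].

Lemma cplx_dsum m n (A : 'M[R]_m) (B : 'M[R]_n) :
  cplx_mx (dsum A B) = dsum (cplx_mx A) (cplx_mx B).
Proof. by rewrite !cplx_mxE map_block_mx !map_mx0. Qed.

Lemma perm_jordan_eigenvalues bs1 bs2 :
  perm_eq bs1 bs2 -> perm_eq (jordan_eigenvalues bs1) (jordan_eigenvalues bs2).
Proof. by move=> pe; apply: perm_flatten; apply: perm_map. Qed.

Lemma real_normal_form_perm T bs1 bs2 : perm_eq bs1 bs2 ->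
  real_normal_form T bs1 -> real_normal_form T bs2.
Proof.
move=> pe [p [d [H1 [K1 [H2 [K2 [dE l1 l2 s e]]]]]]].
exists p, d, H1, K1, H2, K2; split=> //.
- by rewrite dE; apply: A_index_perm.
- by apply: similar_trans s; apply: similar_jordan_mx_perm; rewrite perm_sym.
- by apply: has_exponents_perm e; apply/perm_map/perm_jordan_eigenvalues.
Qed.

Lemma has_exponents_similar m n (H : 'M[R]_m) (H' : 'M[R]_n) es :
  similar_mx (cplx_mx H) (cplx_mx H') -> has_exponents H es -> has_exponents H' es.
Proof.
move=> s [rs [ers prs]]; exists rs; split=> //.
by rewrite /eigenvalues_mult -(similar_char_poly s).
Qed.

Lemma real_normal_form_cat T bs1 bs2 m (H K : 'M[R]_m) :
  real_log T H K -> similar_mx (jordan_mx bs1) (cplx_mx K) ->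
  has_exponents H (cmod_exponents T (jordan_eigenvalues bs1)) ->
  A_index_of_jordan (bs1 ++ bs2) = A_index_of_jordan bs2 ->
  real_normal_form T bs2 -> real_normal_form T (bs1 ++ bs2).
Proof.
move=> lH sK eH Ai [p [d [H1 [K1 [H2 [K2 [dE l1 l2 s e]]]]]]].
exists (m + p)%N, d, (dsum H H1), (dsum K K1), H2, K2; split=> //.
- by rewrite Ai.
- exact: real_log_dsum.
- apply: similar_trans (similar_jordan_mx_cat _ _) _.
  apply: similar_trans (similar_dsum sK s) _.
  by rewrite !cplx_dsum; apply: similar_dsumA.
- apply: (@has_exponents_similar _ _ (dsum H (dsum H1 H2))).
    by rewrite !cplx_dsum; apply: similar_dsumA.
  by rewrite /jordan_eigenvalues map_cat flatten_cat /cmod_exponents map_cat;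
    apply: has_exponents_dsum.
Qed.

Lemma real_normal_form_cons_neg T (x : R) k bs : 0 < T -> x < 0 ->
  (Complex x 0, k) \notin bs ->
  real_normal_form T bs -> real_normal_form T ((Complex x 0, k) :: bs).
Proof.
move=> T0 x0 xbs [p [d [H1 [K1 [H2 [K2 [dE l1 l2 s e]]]]]]].
have x0' : 0 < - x by rewrite oppr_gt0.
pose H := jordan_block (ln (- x) / T, k).
pose K := (- x) *: exp_shift k T.
exists p, (k + d)%N, H1, K1, (dsum H H2), (dsum K K2); split=> //.
- by rewrite A_index_cons_neg // ?dE //= /neg_real /= eqxx.
- by apply: real_log_dsum => //; apply: real_log_pos.
- apply: similar_trans (similar_dsum (similar_refl _) s) _.
  rewrite opp_block_mx !oppr0 !cplx_dsum; apply: similar_trans (similar_dsumCA _ _ _) _.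
  apply: similar_dsum; first exact: similar_refl.
  apply: similar_dsum; last exact: similar_refl.
  apply: similar_sym; rewrite /K -scaleNr opprK cplx_mxE map_mxZ.
  by apply: similar_exp_shift => //; rewrite eq_complex /= eqxx andbT lt_eqF.
- apply: (@has_exponents_similar _ _ (dsum H (dsum H1 H2))).
    by rewrite !cplx_dsum; apply: similar_dsumCA.
  rewrite /jordan_eigenvalues /= /cmod_exponents map_cat; apply: has_exponents_dsum => //.
  rewrite map_nseq cmod_real ltr0_norm //; exact: has_exponents_jordan_block.
Qed.

(** Induction on the number of blocks. The head is removed together with its conjugate or its
    duplicate, or alone if it is real and positive or is a negative block without another copy; each
    removal keeps the list symmetric under conjugation. *)
Lemma real_normal_formP T bs : 0 < T ->
  (forall b, b \in bs -> b.1 != 0) ->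
  (forall b, count_mem b bs = count_mem (b.1^*%C, b.2) bs) ->
  real_normal_form T bs.
Proof.
move=> T0; have [n] := ubnP (size bs); elim: n bs => // n IH [|[l k] bs] sz nz cj.
  exists 0%N, 0%N, 0, 0, 0, 0; split; try exact: real_log_mx0.
  - by rewrite /A_index_of_jordan big_nil.
  - rewrite [X in similar_mx _ X](_ : _ = 0); first exact: similar_refl.
    by apply/matrixP => -[].
  - exists [::]; split=> //.
    by rewrite /eigenvalues_mult /char_poly det_mx00 big_nil.
have l0 : l != 0 by apply: (nz (l, k)); rewrite mem_head.
have nz' b : b \in bs -> b.1 != 0 by move=> h; apply: nz; rewrite inE h orbT.
pose l' := l^*%C.
have pair : (l', k) \in bs -> A_index_of_jordan [:: (l, k), (l', k) & rem (l', k) bs] =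
     A_index_of_jordan (rem (l', k) bs) -> real_normal_form T ((l, k) :: bs).
  move=> lbs Ai; have pe : perm_eq [:: (l, k), (l', k) & rem (l', k) bs] ((l, k) :: bs).
    by rewrite perm_cons perm_sym perm_to_rem.
  apply: (real_normal_form_perm pe).
  have [H [K [lH sK eH]]] := real_log_conj_pair k T0 l0.
  apply: (@real_normal_form_cat _ [:: (l, k); (l', k)] _ _ H K) => //.
  - apply: similar_sym; apply: similar_trans sK _ => /=.
    apply: similar_dsum; first exact: similar_refl.
    by apply: similar_trans (similar_dsumC _ _); apply/similar_sym/similar_dsum0.
  - by rewrite /jordan_eigenvalues /= cats0.
  apply: IH => [|b h|b].
  - by move: sz; rewrite /= size_rem // ltnS; apply: leq_trans; rewrite ltnS leq_pred.
  - by apply: nz'; apply: mem_rem h.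
  case: b => c m.
  (* Conjugation exchanges the indicators of the two removed blocks, so their joint contribution
     cancels from the symmetry equation. *)
  have e1 : ((l, k) == (c^*%C, m)) = ((l', k) == (c, m)).
    by rewrite !xpair_eqE -(inj_eq (can_inj (@conjcK R)) l) conjcK.
  have e2 : ((l', k) == (c^*%C, m)) = ((l, k) == (c, m)).
    by rewrite !xpair_eqE (inj_eq (can_inj (@conjcK R))).
  have := cj (c, m); rewrite -!(seq.permP pe) /= !addnA e1 e2.
  by rewrite [in RHS](addnC (nat_of_bool _)) => /addnI.
(* For a non-real eigenvalue the conjugate block must occur in the tail, by equality of counts;
   neither block is negative real, so the A-index ignores both. *)
have [lre|lnre] := eqVneq l' l; last first.
  have lbs : (l', k) \in bs.
    have := cj (l, k); rewrite /= eqxx -/l' => E.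
    have : (0 < count_mem (l', k) ((l, k) :: bs))%N by rewrite /= -E.
    by rewrite -has_count has_pred1 inE xpair_eqE (negPf lnre).
  apply: pair => //; rewrite !A_index_cons //.
    apply: contra lnre => /andP[]; rewrite /l' eq_complex /=.
    by case: (l) => x y /=; rewrite oppr_eq0 => /eqP-> _; rewrite oppr0 !eqxx.
  apply: contra lnre => /andP[]; rewrite /l' eq_complex /=.
  by case: (l) => x y /=; rewrite ?oppr_eq0 => /eqP-> _; rewrite oppr0 !eqxx.
have [x lE] : exists x : R, l = Complex x 0.
  exists (complex.Re l); move: lre; rewrite /l'; case: (l) => x y [] E.
  by congr Complex; lra.
have cj' b : count_mem b bs = count_mem (b.1^*%C, b.2) bs.
  case: b => c m; have e : ((l, k) == (c^*%C, m)) = ((l, k) == (c, m)).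
    by rewrite !xpair_eqE -{1}lre (inj_eq (can_inj (@conjcK R))).
  by have := cj (c, m); rewrite /= e => /addnI.
have IHbs : real_normal_form T bs by apply: IH => //; rewrite -ltnS.
have [x0|x0|x0] := ltgtP x 0.
(* A negative block with another copy in the tail is paired with it, which preserves parity;
   otherwise it is the only copy and enlarges [K2]. *)
- have [lbs|nlbs] := boolP ((l, k) \in bs).
    by apply: pair; rewrite ?lre // A_index_cons2.
  by rewrite lE; apply: real_normal_form_cons_neg => //; rewrite -lE.
- apply: (@real_normal_form_cat _ [:: (l, k)] _ _ (jordan_block (ln x / T, k))
            (x *: exp_shift k T)) => //.
  + exact: real_log_pos.
  + apply: similar_trans (similar_dsumC _ _) _; apply: similar_trans (similar_dsum0 _ _) _.
    apply: similar_sym; rewrite cplx_mxE map_mxZ lE; apply: similar_exp_shift => //.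
    by rewrite -lE.
  + rewrite /jordan_eigenvalues /= cats0 lE /cmod_exponents map_nseq cmod_real gtr0_norm //.
    exact: has_exponents_jordan_block.
  + by rewrite A_index_cons // lE /neg_real /= (lt_gtF x0) andbF.
- by move: l0; rewrite lE x0 eqxx.
Qed.

Lemma mem_jordan_eigenvalues bs l : l \in jordan_eigenvalues bs ->
  exists2 b, b \in bs & b.1 = l.
Proof.
move=> /flattenP[s /mapP[b bbs ->]]; rewrite mem_nseq => /andP[_ /eqP ->].
by exists b.
Qed.

Lemma jordan_eigenvalues_neq0 n (M : 'M[R]_n) bs l : M \in unitmx ->
  similar_mx (cplx_mx M) (jordan_mx bs) -> l \in jordan_eigenvalues bs -> l != 0.
Proof.
move=> uM sM; apply: contraTneq => ->.
have := char_poly_jordan_mx bs; rewrite -(similar_char_poly sM) => E.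
rewrite -root_prod_XsubC -E /root horner_coef0 char_poly_det mulf_eq0 signr_eq0 /=.
by rewrite cplx_mxE det_map_mx fmorph_eq0 -unitfE -unitmxE.
Qed.

Lemma char_poly_cplx n (M : 'M[R]_n) : char_poly (cplx_mx M) = map_poly rc (char_poly M).
Proof. by rewrite cplx_mxE map_char_poly. Qed.

Lemma eigenvector1_eq0 n (K : 'M[R]_n) (y : 'cV[R]_n) :
  ~~ root (char_poly (cplx_mx K)) 1 -> K *m y = y -> y = 0.
Proof.
move=> nr Ky; apply/eqP; apply: contraNT nr => y0.
rewrite char_poly_cplx -(rmorph1 rc) fmorph_root -char_poly_tr -eigenvalue_root_char.
apply/eigenvalueP; exists y^T; last by rewrite -(inj_eq (@trmx_inj _ _ _)) trmxK trmx0.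
by rewrite -trmx_mul Ky scale1r.
Qed.

(** Hyperbolicity makes the multiplier 1 simple, so its Jordan block is a single 1 that can be split
    off, and the remaining matrix has no nonzero fixed vector. *)
Lemma monodromy_normal_form T n (M : 'M[R]_n) bs : 0 < T -> M \in unitmx ->
  (forall b, b \in bs -> (0 < b.2)%N) ->
  similar_mx (cplx_mx M) (jordan_mx bs) -> hyperbolic_monodromy M ->
  exists p d (H1 K1 : 'M[R]_p) (H2 K2 : 'M[R]_d),
  [/\ d = A_index_of_jordan bs, real_log T H1 K1 /\ real_log T H2 K2,
      similar_mx M (dsum (1%:M : 'M[R]_1) (dsum K1 (- K2))),
      forall y : 'cV[R]_(p + d), dsum K1 (- K2) *m y = y -> y = 0 &
      forall ls, poincare_multipliers M ls ->
        has_exponents (dsum H1 H2) (cmod_exponents T ls)].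
Proof.
move=> T0 uM pos sM [ls0 [pm hyp]].
have nls0 : 1 \notin ls0.
  apply/negP => /hyp; rewrite /cmod /= expr1n expr0n addr0 sqrtr1 eqxx //.
have cpE := char_poly_jordan_mx bs; rewrite -(similar_char_poly sM) -/(jordan_eigenvalues bs) in cpE.
have pe0 : perm_eq (jordan_eigenvalues bs) (1 :: ls0).
  by apply: prod_XsubC_eq; rewrite -cpE pm big_cons.
have c1 : count_mem 1 (jordan_eigenvalues bs) = 1%N.
  by rewrite (seq.permP pe0) /= eqxx (count_memPn nls0).
have /mem_jordan_eigenvalues[b bbs b1] : 1 \in jordan_eigenvalues bs.
  by rewrite (perm_mem pe0) mem_head.
have pe := perm_to_rem bbs; set bs' := rem b bs in pe.
have c1' := c1; rewrite (seq.permP (perm_jordan_eigenvalues pe)) /= in c1'.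
rewrite count_cat count_nseq b1 /= eqxx mul1n in c1'.
(* The multiplicity 1 excludes sizes above one; positivity of block sizes excludes zero. *)
have b2 : b.2 = 1%N by have := pos _ bbs; move: c1'; case: (b.2) => [|[|k]].
have bE : b = (1, 1%N) by case: (b) b1 b2 => a k /= -> ->.
subst b; clear b1 b2.
have n1 : 1 \notin jordan_eigenvalues bs'.
  by apply/count_memPn; case: c1'.
have sbs : similar_mx (jordan_mx bs) (dsum (1%:M : 'M[R[i]]_1) (jordan_mx bs')).
  apply: similar_trans (similar_jordan_mx_perm pe) _ => /=.
  rewrite (_ : jordan_block _ = 1%:M); first exact: similar_refl.
  by apply/matrixP => i j; rewrite !mxE !ord1 /= addr0.
have sub b : b \in bs' -> b \in bs by move=> /mem_rem.
have : real_normal_form T bs'.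
  apply: real_normal_formP => // [b /sub bbs'|b].
    apply: (jordan_eigenvalues_neq0 uM sM); apply/flattenP.
    by exists (nseq b.2 b.1); [exact: map_f|rewrite mem_nseq eqxx pos].
  have := count_jordan_conj b pos sM; rewrite !(seq.permP pe) /=.
  case: b => c m /=; rewrite !xpair_eqE.
  by rewrite -{2}(conjc1 R) (inj_eq (can_inj (@conjcK R))) => /addnI.
move=> [p [d [H1 [K1 [H2 [K2 [dE l1 l2 s e]]]]]]].
exists p, d, H1, K1, H2, K2; split=> //.
- by rewrite dE (A_index_perm pe) A_index_cons //= /neg_real /= (lt_gtF ltr01) andbF.
- have sc : similar_mx (cplx_mx M) (cplx_mx (dsum (1%:M : 'M[R]_1) (dsum K1 (- K2)))).
    apply: similar_trans sM (similar_trans sbs _); rewrite cplx_dsum.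
    apply: similar_dsum => //; rewrite cplx_mxE map_mx1; exact: similar_refl.
  have E := similar_dim sc; subst n; exact: similar_cplx_mx.
- move=> y; apply: eigenvector1_eq0.
  by rewrite -(similar_char_poly s) char_poly_jordan_mx root_prod_XsubC.
- move=> ls; rewrite /poincare_multipliers (similar_char_poly sM) (similar_char_poly sbs).
  rewrite char_poly_dsum char_poly_jordan_mx -/(jordan_eigenvalues bs').
  rewrite (_ : char_poly 1%:M = 'X - 1); last first.
    by rewrite /char_poly det_mx11 !mxE eqxx.
  have X1 : 'X - 1 != 0 :> {poly R[i]} by rewrite polyXsubC_eq0.
  move=> /(mulfI X1)/prod_XsubC_eq pls.
  by apply: has_exponents_perm e; apply: perm_map.
Qed.

End RealJordan.

(** * Functions and curves of class C^k *)

Section C1.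
Variable R : realType.

Lemma is_derive_line (V : normedModType R) (F : V -> R) (y v : V) (s : R) :
  derivable F (s *: v + y) v ->
  is_derive s 1 (fun s => F (s *: v + y)) ('D_v F (s *: v + y)).
Proof.
move=> d.
have E : (fun h : R => h^-1 *: (F ((h *: 1 + s) *: v + y) - F (s *: v + y))) =
         (fun h : R => h^-1 *: (F (h *: v + (s *: v + y)) - F (s *: v + y))).
  by apply/funext => h; rewrite [h *: 1]mulr1 scalerDl addrA.
by split; [rewrite /derivable /= E|rewrite /derive /= E].
Qed.

(** The hypotheses are symmetric in [s] so that increments of either sign are covered. *)
Lemma mean_value_bound (g dg : R -> R) (a c e : R) :
  (forall s : R, `|s| <= `|a| -> is_derive s 1 g (dg s)) ->
  (forall s, `|s| <= `|a| -> `|dg s - c| <= e) ->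
  `|g a - g 0 - a * c| <= `|a| * e.
Proof.
move=> hg hdg.
have [a0|a0|->] := ltgtP a 0; last by rewrite mul0r subr0 subrr normr0 mul0r.
- have [z za E] : exists2 z, z \in `]a, 0[%R & g 0 - g a = dg z * (0 - a).
    apply: MVT => // [x|].
      by rewrite in_itv /= => /andP[ax x0]; apply: hg; rewrite !ler0_norm ?lerN2 ?ltW.
    apply: derivable_within_continuous => x; rewrite in_itv /= => /andP[ax x0].
    by apply: ex_derive; apply: hg; rewrite !ler0_norm ?lerN2 // ltW.
  rewrite (_ : g a - g 0 - a * c = a * (dg z - c)); last by lra.
  rewrite normrM ler_wpM2l // hdg //.
  by move: za; rewrite in_itv /= => /andP[az z0]; rewrite !ler0_norm ?lerN2 ?ltW.
- have [z za E] : exists2 z, z \in `]0, a[%R & g a - g 0 = dg z * (a - 0).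
    apply: MVT => // [x|].
      by rewrite in_itv /= => /andP[ax x0]; apply: hg; rewrite !ger0_norm ?ltW.
    apply: derivable_within_continuous => x; rewrite in_itv /= => /andP[ax x0].
    by apply: ex_derive; apply: hg; rewrite !ger0_norm // ltW.
  rewrite (_ : g a - g 0 - a * c = a * (dg z - c)); last by lra.
  rewrite normrM ler_wpM2l // hdg //.
  by move: za; rewrite in_itv /= => /andP[az z0]; rewrite !ger0_norm ?ltW.
Qed.


Lemma mx_near0_lt m n (e : R) : 0 < e -> \forall h \near (0 : 'M[R]_(m, n)), `|h| < e.
Proof. exact: nbhs0_lt. Qed.

(** [Ck_open] speaks of directional derivatives only, so differentiability has to be derived: move
    one coordinate at a time, apply the mean value theorem to each move, and use continuity of the
    partial derivatives. *)
Lemma C1_expansion n (F : 'cV[R]_n -> R) (x : 'cV[R]_n) :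
  (\forall y \near x, forall j, derivable F y (delta_mx j 0)) ->
  (forall j, {for x, continuous (fun y => 'D_(delta_mx j 0) F y)}) ->
  forall e, 0 < e -> \forall h \near (0 : 'cV[R]_n),
    `|F (h + x) - F x - \sum_j h j 0 * 'D_(delta_mx j 0) F x| <= e * `|h|.
Proof.
(* There are [n] increments to share the error; [n.+1] keeps the denominator nonzero for [n = 0]. *)
move=> dF cF e e0; pose e' := e / n.+1%:R.
have e'0 : 0 < e' by rewrite divr_gt0.
have cF' : \forall y \near x, forall j,
    `|'D_(delta_mx j 0) F y - 'D_(delta_mx j 0) F x| <= e'.
  apply: (filter_forall (nbhs_filter x)) => j; move/cvgrPdist_le : (cF j) => /(_ _ e'0).
  by apply: filterS => y; rewrite distrC.
have [r r0 Hr] : exists2 r : R, 0 < r & forall y, ball x r y ->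
    (forall j, derivable F y (delta_mx j 0)) /\
    (forall j, `|'D_(delta_mx j 0) F y - 'D_(delta_mx j 0) F x| <= e').
  have /nbhs_ballP[r /= r0 Hr] : nbhs x [set y |
      (forall j, derivable F y (delta_mx j 0)) /\
      (forall j, `|'D_(delta_mx j 0) F y - 'D_(delta_mx j 0) F x| <= e')].
    exact: filterI dF cF'.
  by exists r.
near=> h.
have hr : `|h| < r by near: h; apply: mx_near0_lt.
(* [hk k] keeps the first [k] coordinates of [h], giving a path from 0 to [h] along the axes. *)
pose hk (k : nat) : 'cV[R]_n := \col_i (if (i < k)%N then h i 0 else 0).
have hk_le k (l : 'I_n) s : `|s| <= `|h l 0| -> (l = k :> nat) ->
    ball x r (s *: delta_mx l 0 + (hk k + x)).
  move=> sl lk; rewrite -ball_normE /ball_ /= distrC addrA addrK.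
  apply: le_lt_trans hr.
  apply: mx_norm_le => // i j; rewrite !ord1 !mxE eqxx andbT.
  case: (eqVneq i l) => [->|il].
    by rewrite lk ltnn addr0 mulr1 (le_trans sl) // mx_entry_norm.
  by rewrite mulr0 add0r; case: ifP => _; rewrite ?normr0 // mx_entry_norm.
have E0 : hk 0%N = 0 by apply/matrixP => i j; rewrite !mxE.
have En : hk n = h by apply/matrixP => i j; rewrite !mxE ltn_ord !ord1.
have step (k : 'I_n) : hk k.+1 = h k 0 *: delta_mx k 0 + hk k.
  apply/matrixP => i j; rewrite !mxE !ord1 eqxx andbT ltnS leq_eqVlt val_eqE.
  case: (eqVneq i k) => [->|ik] /=; first by rewrite ltnn addr0 mulr1.
  by rewrite mulr0 add0r.
have -> : F (h + x) - F x = \sum_(k < n) (F (hk k.+1 + x) - F (hk k + x)).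
  by rewrite -(big_mkord xpredT (fun k => F (hk k.+1 + x) - F (hk k + x))) telescope_sumr // En E0 add0r.
rewrite -sumrB; apply: le_trans (ler_norm_sum _ _ _) _.
apply: (@le_trans _ _ (\sum_(k < n) `|h| * e')).
  apply: ler_sum => k _; rewrite step -[_ + _ + x]addrA.
  apply: (@le_trans _ _ (`|h k 0| * e')); last by rewrite ler_wpM2r ?mx_entry_norm // ltW.
  have := @mean_value_bound (fun s => F (s *: delta_mx k 0 + (hk k + x)))
    (fun s => 'D_(delta_mx k 0) F (s *: delta_mx k 0 + (hk k + x))) (h k 0)
    ('D_(delta_mx k 0) F x) e'.
  rewrite /= scale0r add0r; apply => s sh.
    by apply: is_derive_line; have [] := Hr _ (hk_le _ _ _ sh erefl).
  by have [_] := Hr _ (hk_le _ _ _ sh erefl).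
rewrite sumr_const card_ord -[leLHS]mulr_natr -mulrA [leRHS]mulrC ler_wpM2l //.
by rewrite /e' -mulrA ler_piMr ?(ltW e0) // mulrC ler_pdivrMr ?ltr0n // mul1r ler_nat.
Unshelve. all: by end_near. Qed.


Lemma Ck_open_S k n (D : set 'cV[R]_n) (W : normedModType R) (F : 'cV[R]_n -> W) :
  Ck_open k.+1 D F -> Ck_open k D F.
Proof.
move=> [oD [dF cF]]; split=> //; split=> [vs v sz|vs sz].
  by apply: dF; apply: ltn_trans sz _.
by apply: cF; apply: leq_trans sz _.
Qed.

Lemma Ck_open_le k l n (D : set 'cV[R]_n) (W : normedModType R) (F : 'cV[R]_n -> W) :
  (k <= l)%N -> Ck_open l D F -> Ck_open k D F.
Proof.
move=> /subnK <-; elim: (l - k)%N => // m IH; rewrite addSn => /Ck_open_S.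
exact: IH.
Qed.

Lemma Ck_open_derive k n (D : set 'cV[R]_n) (W : normedModType R)
    (F : 'cV[R]_n -> W) (e : 'cV[R]_n) :
  Ck_open k.+1 D F -> Ck_open k D (fun x => 'D_e F x).
Proof.
move=> [oD [dF cF]].
have E vs : Defs.iterD vs (fun x => 'D_e F x) = Defs.iterD (rcons vs e) F.
  by rewrite /Defs.iterD foldr_rcons.
split=> //; split=> [vs v sz|vs sz]; rewrite E.
  by apply: dF; rewrite size_rcons.
by apply: cF; rewrite size_rcons.
Qed.

Lemma C1_jacobian_expansion n (D : set 'cV[R]_n) (F : 'cV[R]_n -> 'cV[R]_n) x :
  Ck_open 1 D F -> D x -> forall e, 0 < e -> \forall h \near (0 : 'cV[R]_n),
    `|F (h + x) - F x - jacobian_cV F x *m h| <= e * `|h|.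
Proof.
move=> [oD [dF cF]] Dx e e0.
have nD : \forall y \near x, D y by exact: open_nbhs_nbhs.
have dF' y j : D y -> derivable F y (delta_mx j 0) by move=> Dy; apply: (dF [::]).
have H (i : 'I_n) : \forall h \near (0 : 'cV[R]_n),
    `|F (h + x) i 0 - F x i 0 -
      \sum_j h j 0 * 'D_(delta_mx j 0) (fun y => F y i 0) x| <= e * `|h|.
  apply: (@C1_expansion n (fun y => F y i 0)) => // [|j].
    apply: filterS nD => y Dy j; have /derivable_mxP := dF' y j Dy; exact.
  have /continuous_mxP/(_ i 0) : {for x, continuous (fun y => 'D_(delta_mx j 0) F y)}.
    by apply: (cF [:: delta_mx j 0]) => //; rewrite inE.
  move=> cc.
  have E : 'D_(delta_mx j 0) (fun y => F y i 0) x = ('D_(delta_mx j 0) F x) i 0.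
    by rewrite derive_mx ?mxE //; apply: dF'.
  rewrite /prop_for /continuous_at E; apply: cvg_trans cc.
  apply: (@near_eq_cvg _ _ (nbhs x)); near=> y; have Dy : D y by near: y.
  by rewrite /= derive_mx ?mxE //; apply: dF'.
have := filter_forall (nbhs_filter (0 : 'cV[R]_n)) H.
apply: filterS => h Hh; apply: mx_norm_le => [|i j]; first by rewrite mulr_ge0 // ltW.
rewrite !ord1; have := Hh i; rewrite !mxE.
rewrite (eq_bigr (fun j => jacobian_cV F x i j * h j 0)) // => k _.
by rewrite mulrC mxE derive_mx ?mxE //; apply: dF'.
Unshelve. all: by end_near. Qed.

Lemma continuous_mulmxr m n p (A : 'M[R]_(m, n)) :
  continuous (mulmx A : 'M[R]_(n, p) -> 'M[R]_(m, p)).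
Proof.
by move=> x; apply: (@continuous_mulmx _ _ _ _ _ (cst A) id); [apply: cst_continuous|apply: cvg_id].
Qed.

Lemma C1_is_diff n (D : set 'cV[R]_n) (F : 'cV[R]_n -> 'cV[R]_n) x :
  Ck_open 1 D F -> D x -> is_diff x F (mulmx (jacobian_cV F x)).
Proof.
move=> CF Dx.
have o : F \o shift x = cst (F x) + mulmx (jacobian_cV F x) +o_ (0 : 'cV[R]_n) id.
  apply/eqaddoP => e e0; have := C1_jacobian_expansion CF Dx e0.
  by apply: filterS => h; rewrite opprD addrA.
have dE : 'd F x = mulmx (jacobian_cV F x) :> ('cV[R]_n -> 'cV[R]_n).
  apply: diff_unique => //; exact: continuous_mulmxr.
split=> //; apply/diff_locallyP; rewrite dE; split=> //; exact: continuous_mulmxr.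
Qed.

Lemma is_derive_C1_comp n (D : set 'cV[R]_n) (F : 'cV[R]_n -> 'cV[R]_n)
    (phi : R -> 'cV[R]_n) (t : R) dphi :
  Ck_open 1 D F -> D (phi t) -> is_derive t 1 phi dphi ->
  is_derive t 1 (fun u => F (phi u)) (jacobian_cV F (phi t) *m dphi).
Proof.
move=> CF Dp [/derivable1_diffP dp dpE].
have [dF dFE] := C1_is_diff CF Dp.
have dc : differentiable (F \o phi) t by exact: differentiable_comp.
split; first exact/derivable1_diffP.
by rewrite deriveE // diff_comp //= dFE -dpE deriveE.
Qed.

Lemma zero_diff_at0P p (W : normedModType R) (F : 'cV[R]_p -> W) : F 0 = 0 ->
  (forall e, 0 < e -> \forall h \near (0 : 'cV[R]_p), `|F h| <= e * `|h|) ->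
  zero_diff_at0 F.
Proof.
move=> F0 oF.
have o : F \o shift 0 = cst (F 0) + \0 +o_ (0 : 'cV[R]_p) id.
  apply/eqaddoP => e e0; have := oF _ e0.
  by apply: filterS => h; rewrite /= !fctE /= addr0 F0 !addr0 subr0.
have c0 : continuous (\0 : 'cV[R]_p -> W) by apply: cst_continuous.
have dE : 'd F 0 = \0 :> ('cV[R]_p -> W) by exact: diff_unique.
by split=> //; apply/diff_locallyP; rewrite dE.
Qed.

(** One-variable smoothness by recursion on the ordinary derivative, better suited to bootstrapping
    than lists of directions. *)
Fixpoint Ck_curve k (F : R -> R) : Prop :=
  if k is k'.+1 then (forall t : R, derivable F t 1) /\ Ck_curve k' (derive1 F)
  else continuous F.

Lemma Ck_curve_S k F : Ck_curve k.+1 F -> Ck_curve k F.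
Proof.
elim: k F => [|k IH] F [dF CF].
  by move=> t; apply: differentiable_continuous; apply/derivable1_diffP.
by split=> //; apply: IH.
Qed.

Lemma Ck_curve_cst k c : Ck_curve k (cst c).
Proof.
elim: k c => [|k IH] c; first by move=> t; apply: cvg_cst.
split=> [t|]; first exact: derivable_cst.
by rewrite (_ : derive1 _ = cst 0) //; apply/funext => t; rewrite derive1_cst.
Qed.

Lemma Ck_curve_D k F G : Ck_curve k F -> Ck_curve k G ->
  Ck_curve k (fun t => F t + G t).
Proof.
elim: k F G => [|k IH] F G; first by move=> cF cG t; apply: cvgD; [exact: cF|exact: cG].
move=> [dF CF] [dG CG]; split=> [t|]; first exact: derivableD.
rewrite (_ : derive1 _ = fun t => derive1 F t + derive1 G t); first exact: IH.
by apply/funext => t; rewrite !derive1E -deriveD.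
Qed.

Lemma Ck_curve_M k F G : Ck_curve k F -> Ck_curve k G ->
  Ck_curve k (fun t => F t * G t).
Proof.
elim: k F G => [|k IH] F G; first by move=> cF cG t; apply: cvgM; [exact: cF|exact: cG].
move=> CF CG; have [dF CF'] := CF; have [dG CG'] := CG.
split=> [t|]; first exact: derivableM.
rewrite (_ : derive1 _ = fun t => F t * derive1 G t + G t * derive1 F t).
  by apply: Ck_curve_D; apply: IH => //; apply: Ck_curve_S.
by apply/funext => t; rewrite !derive1E -[RHS]deriveM.
Qed.

Lemma Ck_curve_sum k I (r : seq I) (F : I -> R -> R) :
  (forall i, Ck_curve k (F i)) -> Ck_curve k (fun t => \sum_(i <- r) F i t).
Proof.
move=> CF; elim: r => [|i r IH].
  rewrite (_ : (fun t => _) = cst 0); first exact: Ck_curve_cst.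
  by apply/funext => t; rewrite big_nil.
rewrite (_ : (fun t => _) = fun t => F i t + \sum_(i <- r) F i t).
  exact: Ck_curve_D.
by apply/funext => t; rewrite big_cons.
Qed.

Lemma Ck_curve_continuous k F : Ck_curve k F -> continuous F.
Proof. by elim: k => // k IH /Ck_curve_S/IH. Qed.

Lemma Ck_curve_derive k F dF : (forall t : R, is_derive t 1 F (dF t)) ->
  Ck_curve k dF -> Ck_curve k.+1 F.
Proof.
move=> hF CdF; split=> [t|]; first by have [] := hF t.
rewrite (_ : derive1 F = dF) //; apply/funext => t.
by rewrite derive1E; have [_ ->] := hF t.
Qed.

(** On the line, the derivative in direction [v] is [v] times the ordinary one, so iterated
    directional derivatives are constant multiples of ordinary ones. *)
Lemma Ck_open_curve r m n (U : R -> 'M[R]_(m, n)) :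
  (forall i j, Ck_curve r (fun t => U t i j)) -> Ck_open r setT U.
Proof.
move=> CU.
have iter vs k : (size vs + k = r)%N ->
    forall i j, Ck_curve k (fun t => Defs.iterD vs U t i j).
  elim: vs k => [|v vs IH] k /= sz i j; first by rewrite -sz in CU; apply: CU.
  have CG := IH k.+1 _; rewrite addnS -sz addSn in CG; have {}CG := CG erefl.
  have dG (t : R) : differentiable (Defs.iterD vs U) t.
    by apply/derivable1_diffP/derivable_mxP => a b; have [] := CG a b.
  rewrite (_ : (fun t => _) = fun t => v * derive1 (fun t => Defs.iterD vs U t i j) t).
    by apply: Ck_curve_M; [exact: Ck_curve_cst|have [] := CG i j].
  apply/funext => t; rewrite deriveE // -[v in LHS]mulr1 linearZ /= mxE -deriveE //.
  congr (_ * _); rewrite derive_mx; last exact: diff_derivable.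
  by rewrite mxE derive1E.
split; first exact: openT.
split=> [vs v sz x _|vs sz x _].
  apply: diff_derivable; apply/derivable1_diffP/derivable_mxP => i j.
  have := iter vs (r - size vs)%N (subnKC (ltnW sz)) i j.
  by rewrite -(ltn_predK (_ : 0 < r - size vs)%N) ?subn_gt0 // => -[].
apply/continuous_mxP => i j.
exact: Ck_curve_continuous (iter vs (r - size vs)%N (subnKC sz) i j) x.
Qed.

(** Differentiating [F (phi t)] yields products of partial derivatives of [F] and components of [f]
    along [phi], both covered by the induction hypothesis; smoothness of [phi] is never assumed in
    advance. *)
Lemma Ck_curve_comp_flow n r (D : set 'cV[R]_n) (f : 'cV[R]_n -> 'cV[R]_n)
    (phi : R -> 'cV[R]_n) :
  Ck_open r D f -> (forall t, D (phi t)) ->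
  (forall t : R, is_derive t 1 phi (f (phi t))) ->
  forall k (F : 'cV[R]_n -> 'cV[R]_n), (k <= r)%N -> Ck_open k D F ->
  forall i, Ck_curve k (fun t => F (phi t) i 0).
Proof.
move=> Cf Dp dp; elim=> [|k IH] F kr CF i.
  have [_ [_ /(_ [::] isT) cF]] := CF.
  move=> t; have /continuous_mxP/(_ i 0) : {for t, continuous (F \o phi)}.
    apply: continuous_comp; first exact: is_derive_continuous (dp t).
    by apply: cF; rewrite inE.
  by apply.
apply: (@Ck_curve_derive _ _ (fun t => \sum_j 'D_(delta_mx j 0) F (phi t) i 0 * f (phi t) j 0)).
  move=> t; have CF1 : Ck_open 1 D F by apply: Ck_open_le CF.
  have /is_derive_mxP/(_ i 0) := is_derive_C1_comp CF1 (Dp t) (dp t).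
  by rewrite mxE (eq_bigr (fun j => 'D_(delta_mx j 0) F (phi t) i 0 * f (phi t) j 0)) // => j _; rewrite mxE.
apply: Ck_curve_sum => j; apply: Ck_curve_M.
  by apply: (IH (fun x => 'D_(delta_mx j 0) F x)); [exact: ltnW|exact: Ck_open_derive].
by apply: IH; [exact: ltnW|apply: Ck_open_le Cf; exact: ltnW].
Qed.

(** Bootstrap: the right-hand side is as smooth as the worse of [A] and [U], so [U] ends one order
    above [A]. *)
Lemma Ck_curve_linear_ode r m n (A : R -> 'M[R]_m) (H : 'M[R]_n) (U : R -> 'M[R]_(m, n)) :
  (forall i j, Ck_curve r (fun t => A t i j)) ->
  (forall t : R, is_derive t 1 U (A t *m U t - U t *m H)) ->
  forall i j, Ck_curve r.+1 (fun t => U t i j).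
Proof.
move=> CA dU.
have step k : (forall i j, Ck_curve k (fun t => A t i j)) ->
    (forall i j, Ck_curve k (fun t => U t i j)) ->
    forall i j, Ck_curve k.+1 (fun t => U t i j).
  move=> CA' CU i j.
  apply: (@Ck_curve_derive _ _
    (fun t => \sum_l A t i l * U t l j + \sum_l U t i l * - H l j)).
    move=> t; have /is_derive_mxP/(_ i j) := dU t; rewrite !mxE -sumrN.
    by under [X in _ + X]eq_bigr do rewrite -mulrN.
  apply: Ck_curve_D; apply: Ck_curve_sum => l; apply: Ck_curve_M => //.
  exact: Ck_curve_cst.
elim: r CA => [|r IH] CA; apply: step => //.
  move=> i j t; have /continuous_mxP := is_derive_continuous (dU t); exact.
by apply: IH => i j; apply: Ck_curve_S.
Qed.

End C1.

(** * Coordinates along a periodic orbit *)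

Section RankOne.
Variables (F : fieldType) (m : nat).

(* The solution of the system (B + b e0^T) w = z, by the Sherman-Morrison formula. *)
Definition rank1_solve (B : 'M[F]_(1 + m)) (b z : 'cV[F]_(1 + m)) :=
  let u := invmx B *m z in let c := invmx B *m b in
  u - (u ord0 0 / (1 + c ord0 0)) *: c.

Lemma rank1_solveP B b w z : B \in unitmx -> 1 + (invmx B *m b) ord0 0 != 0 ->
  B *m w + w ord0 0 *: b = z <-> w = rank1_solve B b z.
Proof.
move=> uB; rewrite /rank1_solve; set c := invmx B *m b; set u := invmx B *m z => c0.
have -> : B *m w + w ord0 0 *: b = z <-> w + w ord0 0 *: c = u.
  split=> [E|E].
    by rewrite /u -E mulmxDr mulKmx // -scalemxAr.
  by rewrite -[z](mulKVmx uB) -/u -E mulmxDr -scalemxAr mulKVmx.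
split=> [<-|->].
  have -> : (w + w ord0 0 *: c) ord0 0 = w ord0 0 * (1 + c ord0 0).
    by rewrite mxE [X in _ + X]mxE mulrDr mulr1.
  by rewrite mulfK // addrK.
set k := u ord0 0 / _.
have -> : (u - k *: c) ord0 0 = k.
  by rewrite mxE [X in _ + X]mxE [X in - X]mxE /k; field.
by rewrite subrK.
Qed.

Lemma rank1_solveD B b z z' :
  rank1_solve B b (z + z') = rank1_solve B b z + rank1_solve B b z'.
Proof.
rewrite /rank1_solve mulmxDr [X in (X / _) *: _]mxE mulrDl scalerDl opprD.
by rewrite addrACA.
Qed.

End RankOne.

Lemma col_mx_ord0 (R : Type) m (a : 'M[R]_1) (b : 'cV[R]_m) : col_mx a b ord0 0 = a 0 0.
Proof.
have -> : (ord0 : 'I_(1 + m)) = lshift m 0 by apply: val_inj.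
by rewrite col_mxEu.
Qed.

(** * Norm bounds and extension by periodicity *)

Section Norms.
Variable R : realType.

Lemma norm_col_mx_le m1 m2 n (A : 'M[R]_(m1, n)) (B : 'M[R]_(m2, n)) e : 0 <= e ->
  (`|col_mx A B| <= e) = (`|A| <= e) && (`|B| <= e).
Proof.
move=> e0; apply/idP/andP => [h|[hA hB]].
  by split; apply: mx_norm_le => // i j; apply: le_trans h;
    rewrite -?(col_mxEu A B) -?(col_mxEd A B) mx_entry_norm.
apply: mx_norm_le => // i j; case: (split_ordP i) => k ->.
  by rewrite col_mxEu (le_trans _ hA) // mx_entry_norm.
by rewrite col_mxEd (le_trans _ hB) // mx_entry_norm.
Qed.

Lemma norm_usubmx m1 m2 n (A : 'M[R]_(m1 + m2, n)) : `|usubmx A| <= `|A|.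
Proof. by have := lexx `|A|; rewrite -{1}[A]vsubmxK norm_col_mx_le // => /andP[]. Qed.

Lemma norm_dsubmx m1 m2 n (A : 'M[R]_(m1 + m2, n)) : `|dsubmx A| <= `|A|.
Proof. by have := lexx `|A|; rewrite -{1}[A]vsubmxK norm_col_mx_le // => /andP[]. Qed.

(** The denominator is at least 1/2, so the correction term has norm at most that of [u]; this is
    the factor 2. *)
Lemma rank1_solve_bound m (B : 'M[R]_(1 + m)) (b z : 'cV[R]_(1 + m)) :
  `|invmx B *m b| <= 2^-1 ->
  `|rank1_solve B b z| <= 2 * (1 + m)%:R * `|invmx B| * `|z|.
Proof.
move=> hc; rewrite /rank1_solve; set c := invmx B *m b in hc *; set u := invmx B *m z.
have hu : `|u| <= (1 + m)%:R * `|invmx B| * `|z| by exact: mx_norm_mulmx.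
have c0 : `|c ord0 0| <= 2^-1 by exact: le_trans (mx_entry_norm _ _ _) hc.
have c1 : 2^-1 <= 1 + c ord0 0 by move: c0; rewrite ler_norml => /andP[]; lra.
apply: le_trans (ler_normB _ _) _; rewrite normrZ normrM normfV.
have q : `|u ord0 0| / `|1 + c ord0 0| <= `|u| * 2.
  rewrite ler_pM ?invr_ge0 // ?mx_entry_norm //.
  rewrite -[leRHS]invrK lef_pV2 ?posrE ?invr_gt0 // ?normr_gt0.
    by rewrite (le_trans c1) // ler_norm.
  by rewrite gt_eqF // (lt_le_trans _ c1).
have q' : `|u ord0 0| / `|1 + c ord0 0| * `|c| <= `|u|.
  have := ler_pM _ (normr_ge0 c) q hc; rewrite mulfK // => -> //.
by apply: le_trans (lerD (lexx _) q') _; rewrite -!mulrA; move: hu; rewrite -!mulrA; lra.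
Qed.

Lemma periodic_extension (P : R -> Prop) T : 0 < T ->
  (forall s, P s -> P (s + T)) -> (forall s, P (s + T) -> P s) ->
  (forall s, 0 <= s <= T -> P s) -> forall s, P s.
Proof.
move=> T0 up down base s.
have upn k u : P u -> P (u + k%:R * T).
  by elim: k => [|k IH] Pu; rewrite ?mul0r ?addr0 // -natr1 mulrDl mul1r addrA; apply/up/IH.
have downn k u : P (u + k%:R * T) -> P u.
  elim: k => [|k IH]; rewrite ?mul0r ?addr0 // -natr1 mulrDl mul1r addrA.
  by move=> /down/IH.
pose k := Num.floor (s / T); pose s0 := s - k%:~R * T.
have Ps0 : P s0.
  apply: base; rewrite /s0 subr_ge0 -ler_pdivlMr // floor_le /=.
  rewrite lerBlDr -[X in _ <= X + _]mul1r -mulrDl -ler_pdivrMr // addrC.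
  by have := floorD1_gt (s / T); rewrite intrD => /ltW.
have -> : s = s0 + k%:~R * T by rewrite subrK.
case: k @s0 Ps0 => k s0 Ps0; first exact: upn.
apply: (downn k.+1); rewrite NegzE mulrNz mulNr subrK //.
Qed.

End Norms.

Section Coordinates.
Variables (R : realType) (m : nat).
Local Notation n := (1 + m)%N.
Variables (D : set 'cV[R]_n) (f : 'cV[R]_n -> 'cV[R]_n) (phi : R -> 'cV[R]_n).
Variables (T : R) (S H : 'M[R]_m) (U : R -> 'M[R]_(n, m)).
Let A t := jacobian_cV f (phi t).
Let V t := A t *m U t - U t *m H.
Hypothesis T_gt0 : 0 < T.
Hypothesis f_C1 : Ck_open 1 D f.
Hypothesis D_phi : forall t, D (phi t).
Hypothesis dphi : forall t : R, is_derive t 1 phi (f (phi t)).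
Hypothesis phiT : forall t, phi (t + T) = phi t.
Hypothesis dU : forall t : R, is_derive t 1 U (V t).
Hypothesis UT : forall t, U (t + T) = U t *m S.
Hypothesis A_continuous : continuous A.
Hypothesis SS : S *m S = 1%:M.
Hypothesis SH : S *m H = H *m S.
Hypothesis S_norm : forall x : 'cV[R]_m, `|S *m x| <= `|x|.

Definition frame s : 'M[R]_n := row_mx (f (phi s)) (U s).
Hypothesis frame_unit : forall s, frame s \in unitmx.

Definition point s x := phi s + U s *m x.
(** The coordinate velocity [(s', x')] of a point that moves with velocity [z]. *)
Definition pullback s x z := rank1_solve (frame s) (V s *m x) z.
Definition twist : 'M[R]_n := dsum 1%:M S.

Lemma twistK : twist *m twist = 1%:M.
Proof. by rewrite mul_dsum mulmx1 SS -scalar_mx_block. Qed.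

Lemma twist_norm (y : 'cV[R]_n) : `|twist *m y| <= `|y|.
Proof.
rewrite -[y in leLHS]vsubmxK /twist mul_block_col !mul0mx addr0 add0r mul1mx.
rewrite norm_col_mx_le // norm_usubmx /=.
exact: le_trans (S_norm _) (norm_dsubmx _).
Qed.

Lemma twist0 (y : 'cV[R]_n) : (twist *m y) ord0 0 = y ord0 0.
Proof.
rewrite -[y]vsubmxK /twist mul_block_col !mul0mx addr0 mul1mx.
by rewrite !col_mx_ord0.
Qed.

Lemma AT t : A (t + T) = A t. Proof. by rewrite /A phiT. Qed.

Lemma VT t : V (t + T) = V t *m S.
Proof. by rewrite /V AT UT mulmxBl !mulmxA -[U t *m S *m H]mulmxA SH mulmxA. Qed.

Lemma pointT s x : point (s + T) x = point s (S *m x).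
Proof. by rewrite /point phiT UT mulmxA. Qed.

Lemma frameT s : frame (s + T) = frame s *m twist.
Proof.
by rewrite /frame /twist phiT UT mul_row_block mulmx1 !mulmx0 addr0 add0r.
Qed.

Lemma inv_frameT s : invmx (frame (s + T)) = twist *m invmx (frame s).
Proof.
apply: (can_inj (mulKmx (frame_unit (s + T)))).
by rewrite mulmxV // frameT mulmxA -[_ *m twist *m twist]mulmxA twistK mulmx1 mulmxV.
Qed.

(** The rank one correction seen in the frame; the velocity equation is solvable as long as its
    first entry is not -1. *)
Definition drift s (x : 'cV[R]_m) := invmx (frame s) *m (V s *m x).

Lemma driftT s x : drift (s + T) x = twist *m drift s (S *m x).
Proof. by rewrite /drift inv_frameT VT !mulmxA. Qed.

(** The twist leaves the first entry alone, so the denominator of the rank one formula is unchanged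
    and the twist factors out. *)
Lemma pullbackT s x z : pullback (s + T) x z = twist *m pullback s (S *m x) z.
Proof.
rewrite /pullback /rank1_solve -!/(drift _ _) driftT inv_frameT -mulmxA !twist0.
by rewrite mulmxBr -scalemxAr.
Qed.

Lemma is_derive_frame (s : R) :
  is_derive s 1 frame (row_mx (A s *m f (phi s)) (V s)).
Proof.
have /is_derive_mxP h1 := is_derive_C1_comp f_C1 (D_phi s) (dphi s).
have /is_derive_mxP h2 := dU s.
apply/is_derive_mxP => i j; case: (split_ordP j) => j' ->.
  rewrite row_mxEl [X in is_derive _ _ X](_ : _ = fun x => f (phi x) i j') //.
  by apply/funext => x; rewrite row_mxEl.
rewrite row_mxEr [X in is_derive _ _ X](_ : _ = fun x => U x i j') //.
by apply/funext => x; rewrite row_mxEr.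
Qed.

Lemma inv_frame_continuous : continuous (fun s => invmx (frame s)).
Proof. by move=> s; apply: is_derive_continuous (is_derive_invmx frame_unit is_derive_frame s). Qed.

Lemma U_continuous : continuous U.
Proof. by move=> s; apply: is_derive_continuous (dU s). Qed.

Lemma V_continuous : continuous V.
Proof.
move=> s; apply: cvgB.
  by apply: continuous_mulmx; [exact: A_continuous|exact: U_continuous].
by apply: continuous_mulmx; [exact: U_continuous|exact: cst_continuous].
Qed.

Definition good_at (delta C s : R) := forall x : 'cV[R]_m, `|x| < delta ->
  [/\ D (point s x), `|drift s x| <= 2^-1 &
      forall z, `|pullback s x z| <= C * `|z|].

Lemma good_atT delta C s : good_at delta C s -> good_at delta C (s + T).
Proof.
move=> gs x xd; have := gs (S *m x) (le_lt_trans (S_norm x) xd).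
rewrite -pointT driftT => -[Dz c b]; split=> // [|z].
  exact: le_trans (twist_norm _) c.
by rewrite pullbackT; apply: le_trans (twist_norm _) (b z).
Qed.

Lemma good_atTN delta C s : good_at delta C (s + T) -> good_at delta C s.
Proof.
move=> gs x xd; have := gs (S *m x) (le_lt_trans (S_norm x) xd).
rewrite pointT driftT mulmxA SS mul1mx => -[Dz c b]; split=> // [|z].
  rewrite -[drift s x]mul1mx -twistK -mulmxA; exact: le_trans (twist_norm _) c.
rewrite -[pullback s x z]mul1mx -twistK -mulmxA.
have := b z; rewrite pullbackT mulmxA SS mul1mx.
exact: le_trans (twist_norm _).
Qed.

(** The two conditions on [x] hold strictly or trivially at [x = 0] and are continuous in [(s, x)],
    so compactness of [[0, T]] gives one radius; the twist identities carry it to every [s]. *)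
Lemma good_radius : exists delta C, [/\ 0 < delta, 0 < C & forall s, good_at delta C s].
Proof.
have [s0 _ hs0] : exists2 c, c \in `[0, T]%R &
    forall t, t \in `[0, T]%R -> `|invmx (frame t)| <= `|invmx (frame c)|.
  apply: (@EVT_max R (fun s => `|invmx (frame s)|)); first exact: ltW.
  apply: continuous_subspaceT => s.
  by apply: cvg_norm; apply: inv_frame_continuous.
pose b := `|invmx (frame s0)|.
have [oD _] := f_C1.
have near0 : \forall x \near (0 : 'cV[R]_m), forall s, s \in `[0, T]%R ->
    D (point s x) /\ `|drift s x| <= 2^-1.
  have /compact_near_coveringP := @segment_compact R 0 T.
  move=> /(_ _ (nbhs (0 : 'cV[R]_m)) (fun x s => D (point s x) /\ `|drift s x| <= 2^-1) _) cov.
  have : \forall x \near (0 : 'cV[R]_m), `[0, T] `<=` (fun s => D (point s x) /\ `|drift s x| <= 2^-1).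
    apply: cov => s _.
    have cfst : {for (s, 0 : 'cV[R]_m), continuous (fst : R * 'cV[R]_m -> R)} by exact: cvg_fst.
    have csnd : {for (s, 0 : 'cV[R]_m), continuous (snd : R * 'cV[R]_m -> 'cV[R]_m)} by exact: cvg_snd.
    have c1 : {for (s, 0 : 'cV[R]_m), continuous (fun q : R * 'cV[R]_m => point q.1 q.2)}.
      apply: cvgD.
        by apply: (continuous_comp cfst); apply: is_derive_continuous (dphi s).
      by apply: continuous_mulmx => //; apply: (continuous_comp cfst); apply: U_continuous.
    have c2 : {for (s, 0 : 'cV[R]_m), continuous (fun q : R * 'cV[R]_m => drift q.1 q.2)}.
      apply: continuous_mulmx.
        apply: (@continuous_comp _ _ _ fst (fun s => invmx (frame s))) => //.
        exact: inv_frame_continuous.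
      by apply: continuous_mulmx => //; apply: (@continuous_comp _ _ _ fst V) => //; apply: V_continuous.
    have n1 : \forall q \near (s, 0 : 'cV[R]_m), D (point q.1 q.2).
      apply: c1; apply: open_nbhs_nbhs; split=> //.
      by rewrite /point /= mulmx0 addr0.
    have n2 : \forall q \near (s, 0 : 'cV[R]_m), `|drift q.1 q.2| <= 2^-1.
      move/cvgrPdist_le : c2 => /(_ 2^-1); rewrite /drift /= !mulmx0.
      by under eq_near do rewrite sub0r normrN; apply; rewrite invr_gt0.
    by apply: filterI n1 n2.
  by apply: filterS => x h s hs; apply: h.
move/nbhs_ballP : near0 => [delta /= d0 hd].
(* [b] is the maximum of the norm of the inverse frame over one period; adding 1 makes the constant
   positive. *)
exists delta, (2 * n%:R * b + 1); split=> //.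
  by rewrite ltr_wpDl // mulr_ge0 // normr_ge0.
apply: (periodic_extension T_gt0); [exact: good_atT|exact: good_atTN|].
move=> s sT x xd.
have sT' : s \in `[0, T]%R by rewrite in_itv.
have [] := hd x _ s sT'; first by rewrite -ball_normE /ball_ /= sub0r normrN.
move=> Dz c; split=> // z.
apply: le_trans (rank1_solve_bound z c) _.
apply: ler_wpM2r => //; rewrite ler_wpDr // ler_wpM2l ?mulr_ge0 //.
exact: hs0.
Qed.

Lemma drift_neq0 delta C s x : good_at delta C s -> `|x| < delta ->
  1 + drift s x ord0 0 != 0.
Proof.
move=> gs xd; have [_ c _] := gs x xd.
have : `|drift s x ord0 0| <= 2^-1 by apply: le_trans c; apply: mx_entry_norm.
by rewrite ler_norml => /andP[h _]; rewrite gt_eqF //; lra.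
Qed.

Lemma is_derive_point (s : R -> R) (x : R -> 'cV[R]_m) (t ds : R) dx :
  is_derive t 1 s ds -> is_derive t 1 x dx ->
  is_derive t 1 (fun t => point (s t) (x t))
    (frame (s t) *m col_mx ds%:M dx + ds *: (V (s t) *m x t)).
Proof.
move=> hs hx.
have h1 := is_derive_comp_curve hs (dphi (s t)).
have h2 := is_derive_mulmx (is_derive_comp_curve hs (dU (s t))) hx.
apply: (is_derive_eq (is_deriveD h1 h2)).
rewrite /frame mul_row_col mul_mx_scalar -scalemxAl -addrA; congr (_ + _).
by rewrite addrC.
Qed.

(** The vector [(L0, L1, L2)] stacked: the coordinate velocity minus its part [(1, H x)]. *)
Definition unperturbed s x : 'cV[R]_n :=
  pullback s x (f (point s x)) - col_mx 1%:M (H *m x).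

Lemma unperturbedT s x : unperturbed (s + T) x = twist *m unperturbed s (S *m x).
Proof.
rewrite /unperturbed pullbackT pointT [RHS]mulmxBr; congr (_ - _).
rewrite /twist mul_block_col !mul0mx addr0 add0r mulmx1; congr col_mx.
by rewrite !mulmxA SH -!mulmxA [S *m (S *m x)]mulmxA SS mul1mx.
Qed.

(** [(1, H x)] is exactly the pullback of the first order Taylor polynomial of [f] at [phi s], so
    what is left is the pullback of the Taylor remainder. *)
Lemma unperturbed_small delta C s e : 0 < delta -> 0 < C -> good_at delta C s ->
  0 < e -> \forall x \near (0 : 'cV[R]_m), `|unperturbed s x| <= e * `|x|.
Proof.
move=> d0 C0 gs e0.
pose K' := m%:R * `|U s| + 1.
have K0 : 0 < K' by rewrite ltr_wpDl // mulr_ge0.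
pose e' := e / (C * K').
have e'0 : 0 < e' by rewrite divr_gt0 // mulr_gt0.
have ex := C1_jacobian_expansion f_C1 (D_phi s) e'0.
have cU : (fun x : 'cV[R]_m => U s *m x) @ (0 : 'cV[R]_m) --> (0 : 'cV[R]_n).
  have := @continuous_mulmxr R _ _ 1 (U s) 0; by rewrite /continuous_at mulmx0.
near=> x.
have xd : `|x| < delta by near: x; apply: mx_near0_lt.
have hx : `|f (U s *m x + phi s) - f (phi s) - A s *m (U s *m x)| <= e' * `|U s *m x|.
  by near: x; apply: (cU _ ex).
have E : unperturbed s x = pullback s x (f (U s *m x + phi s) - f (phi s) - A s *m (U s *m x)).
  have wE : col_mx 1%:M (H *m x) = pullback s x (f (phi s) + A s *m (U s *m x)).
    apply: (proj1 (rank1_solveP _ _ (frame_unit s) (drift_neq0 gs xd)) _).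
    rewrite [X in X + _](_ : _ = frame s *m col_mx 1%:M (H *m x)) //.
    rewrite /frame mul_row_col mulmx1 col_mx_ord0 mxE eqxx scale1r.
    (* The terms [U H x] cancel, because [V + U H = A U]. *)
    by rewrite /V mulmxBl -!mulmxA addrA addrAC addrK.
  rewrite /unperturbed wE; apply/eqP; rewrite subr_eq /pullback -rank1_solveD.
  by rewrite -[X in rank1_solve _ _ (X + _)]addrA -opprD subrK /point [phi s + _]addrC.
have [_ _ b] := gs x xd; rewrite E; apply: le_trans (b _) _.
apply: le_trans (ler_wpM2l (ltW C0) hx) _.
have UxK : `|U s *m x| <= K' * `|x|.
  apply: le_trans (mx_norm_mulmx _ _) _; rewrite ler_wpM2r // /K' lerDl //.
rewrite (le_trans (ler_wpM2l (ltW C0) (ler_wpM2l (ltW e'0) UxK))) //.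
rewrite /e' !mulrA ler_wpM2r // (_ : C * e / (C * K') * K' = e) //.
by field; rewrite !gt_eqF.
Unshelve. all: by end_near. Qed.

Lemma unperturbed0 s : unperturbed s 0 = 0.
Proof.
rewrite /unperturbed /pullback /rank1_solve !mulmx0 scaler0 subr0.
rewrite /point mulmx0 addr0.
have -> : f (phi s) = frame s *m col_mx 1%:M 0.
  by rewrite /frame mul_row_col mulmx1 mulmx0 addr0.
by rewrite mulKmx // subrr.
Qed.

Lemma point_ode delta C (s : R -> R) (x : R -> 'cV[R]_m) (t ds : R) dx zg :
  good_at delta C (s t) -> `|x t| < delta ->
  is_derive t 1 s ds -> is_derive t 1 x dx ->
  (derivable (fun t => point (s t) (x t)) t 1 /\
   derive1 (fun t => point (s t) (x t)) t = f (point (s t) (x t)) + zg) <->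
  col_mx ds%:M dx = col_mx 1%:M (H *m x t) + unperturbed (s t) (x t)
                    + pullback (s t) (x t) zg.
Proof.
move=> gs xd hs hx; have /is_derive_derive1[dz dzE] := is_derive_point hs hx.
have E : col_mx 1%:M (H *m x t) + unperturbed (s t) (x t) + pullback (s t) (x t) zg =
    rank1_solve (frame (s t)) (V (s t) *m x t) (f (point (s t) (x t)) + zg).
  by rewrite /unperturbed addrC [X in _ + X]addrC subrK addrC /pullback -rank1_solveD.
have := rank1_solveP (col_mx ds%:M dx) (f (point (s t) (x t)) + zg)
  (frame_unit (s t)) (drift_neq0 gs xd).
rewrite -E col_mx_ord0 mxE eqxx mulr1n => <-; rewrite dzE.
by split=> [[]|].
Qed.

End Coordinates.

(** * Floquet theory of the first variational equation *)

Section Floquet.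
Variable R : realType.

Lemma similar_map (F F' : fieldType) (h : {rmorphism F -> F'}) m n (A : 'M[F]_m) (B : 'M[F]_n) :
  similar_mx A B -> similar_mx (map_mx h A) (map_mx h B).
Proof.
move=> [P [Q [PQ QP AP]]]; exists (map_mx h P), (map_mx h Q).
by rewrite -!map_mxM PQ QP AP !map_mx1.
Qed.

Lemma fundamental_is_derive n (A Phi : R -> 'M[R]_n) : fundamental_matrix A Phi ->
  forall t : R, is_derive t 1 Phi (A t *m Phi t).
Proof. by move=> hP t; apply/is_derive_derive1; have [] := hP t. Qed.

Lemma fundamental_solution n k (A Phi : R -> 'M[R]_n) (X : R -> 'M[R]_(n, k)) :
  fundamental_matrix A Phi -> (forall t : R, is_derive t 1 X (A t *m X t)) ->
  forall t, X t = Phi t *m (invmx (Phi 0) *m X 0).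
Proof.
move=> hP hX t.
have uP u : Phi u \in unitmx by have [] := hP u.
have h (u : R) : is_derive u 1 (fun u => invmx (Phi u) *m X u) 0.
  have := is_derive_mulmx (is_derive_invmx uP (fundamental_is_derive hP) u) (hX u).
  by rewrite !mulmxA mulmxK // mulNmx addNr.
by rewrite -(is_derive0_constant h t 0) mulKVmx.
Qed.

Lemma monodromy_period n (A Phi : R -> 'M[R]_n) T : fundamental_matrix A Phi ->
  (forall t, A (t + T) = A t) -> forall t, Phi (t + T) = Phi t *m monodromy Phi T.
Proof.
move=> hP AT t.
have h (u : R) : is_derive u 1 (fun u : R => Phi (u + T)) (A u *m Phi (u + T)).
  have := is_derive_comp_curve (is_derive_shift u 1 T) (fundamental_is_derive hP (u + T)).
  by rewrite scale1r AT.
by rewrite (fundamental_solution hP h t) add0r.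
Qed.

(** Needed because the A-index is given through a fundamental matrix of its own. *)
Lemma monodromy_similar n (A Phi Psi : R -> 'M[R]_n) T :
  fundamental_matrix A Phi -> fundamental_matrix A Psi ->
  similar_mx (monodromy Phi T) (monodromy Psi T).
Proof.
move=> hP hQ; have E := fundamental_solution hP (fundamental_is_derive hQ).
have uP : Phi 0 \in unitmx by have [] := hP 0.
have uQ : Psi 0 \in unitmx by have [] := hQ 0.
apply: (@similar_unitmx _ _ _ _ (invmx (Phi 0) *m Psi 0)).
  by rewrite unitmx_mul unitmx_inv uP.
by rewrite /monodromy -mulmxA -E !mulmxA mulmxK.
Qed.

(** The velocity of the cycle solves the variational equation and is periodic. If [q] vanished,
    [phi] would be constant, against minimality of the period, tested at [T / 2]. *)
Lemma fundamental_matrix_periodic_vector n (D : set 'cV[R]_n) f phi T Phi :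
  Ck_open 1 D f -> periodic_orbit D f phi T ->
  fundamental_matrix (fun t => jacobian_cV f (phi t)) Phi ->
  exists q : 'cV[R]_n, [/\ q != 0, monodromy Phi T *m q = q &
    forall t, f (phi t) = Phi t *m q].
Proof.
move=> Cf [T0 Dp dp pT np] hP.
have dphi (t : R) : is_derive t 1 phi (f (phi t)) by apply/is_derive_derive1.
have E := fundamental_solution hP (fun t => is_derive_C1_comp Cf (Dp t) (dphi t)).
exists (invmx (Phi 0) *m f (phi 0)); split=> //.
  apply/eqP => q0; apply: (np (T / 2)); first by rewrite divr_gt0 //= ltr_pdivrMr // ltr_pMr // ltr1n.
  apply: is_derive0_constant => t; have := dphi t; by rewrite E q0 mulmx0.
have := E T; rewrite -{1}[T]add0r pT => ET.
by rewrite /monodromy -mulmxA -ET.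
Qed.

(** [K] has no nonzero fixed vector, so [q] is a multiple of the first column of the base change and
    can replace it; the other columns form [Q]. *)
Lemma monodromy_frame m (M : 'M[R]_(1 + m)) (K : 'M[R]_m) q :
  similar_mx M (dsum (1%:M : 'M[R]_1) K) -> (forall y : 'cV[R]_m, K *m y = y -> y = 0) ->
  q != 0 -> M *m q = q ->
  exists Q : 'M[R]_(1 + m, m), row_mx q Q \in unitmx /\ M *m Q = Q *m K.
Proof.
move=> /similar_unitmxP[P uP MP] K1 q0 Mq; exists (rsubmx P).
pose y := invmx P *m q; have yE : q = P *m y by rewrite mulKVmx.
have Ky : dsum (1%:M : 'M[R]_1) K *m y = y.
  by apply: (can_inj (mulKmx uP)); rewrite mulmxA -MP -mulmxA -yE.
move: Ky; rewrite -[y]vsubmxK mul_block_col !mul0mx addr0 add0r mul1mx.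
move=> /eq_col_mx[_ /K1 y1].
have qE : q = lsubmx P *m usubmx y.
  by rewrite yE -{1}[P]hsubmxK -{1}[y]vsubmxK mul_row_col y1 mulmx0 addr0.
split; last first.
  move: MP; rewrite -[P]hsubmxK mul_mx_row mul_row_block mulmx1 !mulmx0 addr0 add0r.
  by rewrite row_mxKr => /eq_row_mx[_].
have -> : row_mx q (rsubmx P) = P *m dsum (usubmx y) 1%:M.
  by rewrite -{2}[P]hsubmxK mul_row_block !mulmx0 addr0 add0r mulmx1 -qE.
rewrite unitmx_mul uP unitmxE det_ublock det1 mulr1 -unitmxE unitmxE unitfE det_mx11.
apply: contra q0 => /eqP y00; rewrite qE [usubmx y](_ : _ = 0) ?mulmx0 //.
by apply/matrixP => a b; rewrite !ord1 y00 mxE.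
Qed.

Lemma mul_sign_mx p d (x : 'cV[R]_(p + d)) :
  (dsum 1%:M (- 1%:M) : 'M[R]_(p + d)) *m x = col_mx (usubmx x) (- dsubmx x).
Proof.
by rewrite -{1}[x]vsubmxK mul_block_col !mul0mx addr0 add0r mul1mx mulNmx mul1mx.
Qed.

Lemma sign_mx_norm p d (x : 'cV[R]_(p + d)) :
  `|(dsum 1%:M (- 1%:M) : 'M[R]_(p + d)) *m x| <= `|x|.
Proof.
by rewrite mul_sign_mx norm_col_mx_le // normrN norm_usubmx norm_dsubmx.
Qed.

Lemma dsubmx_twist m (S : 'M[R]_m) (y : 'cV[R]_(1 + m)) :
  dsubmx (twist S *m y) = S *m dsubmx y.
Proof.
by rewrite -{1}[y]vsubmxK /twist mul_block_col !mul0mx add0r col_mxKd.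
Qed.

Lemma cV3_eqP p d (y z : 'cV[R]_(1 + (p + d))) : y = z <->
  [/\ y ord0 0 = z ord0 0, usubmx (dsubmx y) = usubmx (dsubmx z) &
      dsubmx (dsubmx y) = dsubmx (dsubmx z)].
Proof.
split=> [->//|[]]; rewrite -[y]vsubmxK -[z]vsubmxK !col_mx_ord0 !col_mxKd => e0 e1 e2.
congr col_mx; first by apply/matrixP => i j; rewrite !ord1.
by rewrite -[dsubmx y]vsubmxK -[dsubmx z]vsubmxK e1 e2.
Qed.

Lemma usubmxD m1 m2 n (A B : 'M[R]_(m1 + m2, n)) : usubmx (A + B) = usubmx A + usubmx B.
Proof. by apply/matrixP => i j; rewrite !mxE. Qed.

Lemma dsubmxD m1 m2 n (A B : 'M[R]_(m1 + m2, n)) : dsubmx (A + B) = dsubmx A + dsubmx B.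
Proof. by apply/matrixP => i j; rewrite !mxE. Qed.

End Floquet.

Unset Implicit Arguments.

Theorem theoremB (R : realType) (n r d : nat)
  (D : set 'cV[R]_n) (I : set R)
  (f : 'cV[R]_n -> 'cV[R]_n) (g : R -> 'cV[R]_n -> 'cV[R]_n)
  (phi : R -> 'cV[R]_n) (T : R) (Phi : R -> 'M[R]_n) :
  open D -> is_interval I -> (2 <= r)%N ->
  Ck_open r D f ->
  Ck_on r (I `*` D) (fun p : R * 'cV[R]_n => g p.1 p.2) ->
  periodic_orbit D f phi T ->
  fundamental_matrix (fun t => jacobian_cV f (phi t)) Phi ->
  hyperbolic_monodromy (monodromy Phi T) ->
  A_index (fun t => jacobian_cV f (phi t)) T d ->
  exists (U : R -> 'M[R]_(n, (n - d - 1) + d))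
         (H1 : 'M[R]_(n - d - 1)) (H2 : 'M[R]_d)
         (L0 : R -> 'cV[R]_(n - d - 1) -> 'cV[R]_d -> R)
         (L1 : R -> 'cV[R]_(n - d - 1) -> 'cV[R]_d -> 'cV[R]_(n - d - 1))
         (L2 : R -> 'cV[R]_(n - d - 1) -> 'cV[R]_d -> 'cV[R]_d)
         (Lt0 : R -> R -> 'cV[R]_(n - d - 1) -> 'cV[R]_d -> R)
         (Lt1 : R -> R -> 'cV[R]_(n - d - 1) -> 'cV[R]_d -> 'cV[R]_(n - d - 1))
         (Lt2 : R -> R -> 'cV[R]_(n - d - 1) -> 'cV[R]_d -> 'cV[R]_d)
         (delta C : R),
     (* U is C^r and U(t+T) = U(t) [I_{n-d-1} (+) (-I_d)] *)
     Ck_on r setT U /\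
     (forall t, U (t + T) = U t *m block_mx 1%:M 0 0 (- 1%:M)) /\
     (* (phi'(s), U(s)) has full rank: a genuine change of coordinates *)
     (forall s, \rank (row_mx (derive1 phi s) (U s)) = n) /\
     (* neighbourhood of the cycle *)
     0 < delta /\
       (forall s (x : 'cV[R]_((n - d - 1) + d)), `|x| < delta ->
          D (phi s + U s *m x)) /\
     (* the change of variables z = phi(s) + U(s) [v; w] transforms
        z' = f(z) + g(t,z) into the (s,v,w)-system *)
     (forall (a b : R) (s : R -> R) (v : R -> 'cV[R]_(n - d - 1))
             (w : R -> 'cV[R]_d),
        [set t | a < t < b] `<=` I ->
        (forall t, a < t < b ->
           [/\ derivable s t 1, derivable v t 1, derivable w t 1 &
               `|col_mx (v t) (w t)| < delta]) ->
        (solves_on [set t | a < t < b] (fun t z => f z + g t z)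
           (fun t => phi (s t) + U (s t) *m col_mx (v t) (w t))
         <->
         (forall t, a < t < b ->
           [/\ derive1 s t = 1 + L0 (s t) (v t) (w t) + Lt0 t (s t) (v t) (w t),
               derive1 v t = H1 *m v t + L1 (s t) (v t) (w t)
                             + Lt1 t (s t) (v t) (w t) &
               derive1 w t = H2 *m w t + L2 (s t) (v t) (w t)
                             + Lt2 t (s t) (v t) (w t)]))) /\
     (* (i) real parts of eigenvalues of H1 (+) H2 are (1/T) log |lambda_l| *)
     (forall ls : seq R[i], poincare_multipliers (monodromy Phi T) ls ->
        exists rs : seq R[i],
          eigenvalues_mult (block_mx H1 0 0 H2) rs /\
          perm_eq [seq complex.Re rho | rho <- rs]
                  [seq ln (cmod l) / T | l <- ls]) /\
     (* (ii) *)
     (forall s,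
        [/\ L0 s 0 0 = 0, L1 s 0 0 = 0 & L2 s 0 0 = 0] /\
        [/\ zero_diff_at0 (fun y : 'cV[R]_((n - d - 1) + d) =>
                             L0 s (usubmx y) (dsubmx y)),
            zero_diff_at0 (fun y : 'cV[R]_((n - d - 1) + d) =>
                             L1 s (usubmx y) (dsubmx y)) &
            zero_diff_at0 (fun y : 'cV[R]_((n - d - 1) + d) =>
                             L2 s (usubmx y) (dsubmx y))]) /\
     (* (iii) and (iv) *)
     (forall s v w, `|col_mx v w| < delta ->
        [/\ L0 (s + T) v w = L0 s v (- w),
            L1 (s + T) v w = L1 s v (- w) &
            L2 (s + T) v w = - L2 s v (- w)]) /\
     (forall t s v w, I t -> `|col_mx v w| < delta ->
        [/\ Lt0 t (s + T) v w = Lt0 t s v (- w),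
            Lt1 t (s + T) v w = Lt1 t s v (- w) &
            Lt2 t (s + T) v w = - Lt2 t s v (- w)]) /\
     (* (v) *)
     0 < C /\
     (forall t s v w, I t -> `|col_mx v w| < delta ->
        let gz := `|g t (phi s + U s *m col_mx v w)| in
        [/\ `|Lt0 t s v w| <= C * gz,
            `|Lt1 t s v w| <= C * gz &
            `|Lt2 t s v w| <=  C * gz]).
Proof.
move=> oD _ r2 Cf _ po hPhi hyp [Psi [bs [hPsi jbs dE]]].
have Cf1 : Ck_open 1 D f by apply: Ck_open_le Cf; apply: leq_trans r2.
have [T0 Dp dp pT _] := po.
have [q [q0 Mq qE]] := fundamental_matrix_periodic_vector Cf1 po hPhi.
have sM : similar_mx (cplx_mx (monodromy Phi T)) (jordan_mx bs).
  apply: similar_trans (jordan_form_similar jbs).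
  by rewrite !cplx_mxE; apply: similar_map; apply: monodromy_similar hPhi hPsi.
have uPhi t : Phi t \in unitmx by have [] := hPhi t.
have uM : monodromy Phi T \in unitmx by rewrite unitmx_mul unitmx_inv !uPhi.
have [pos _ _] := jbs.
have [p [d' [H1 [K1 [H2 [K2 [d'E [l1 l2] sK K1y ex]]]]]]] :=
  monodromy_normal_form T0 uM pos sM hyp.
rewrite -dE in d'E; clear dE; subst d'.
(* The similarity gives [n = 1 + (p + d)], which identifies [p] with the truncated difference in the
   statement. *)
have nE := similar_dim sK.
have pE : p = (n - d - 1)%N by rewrite nE; lia.
rewrite -pE; clear pE.
subst n.
have dphi (t : R) : is_derive t 1 phi (f (phi t)) by apply/is_derive_derive1.
have [Q [uQ MQ]] := monodromy_frame sK K1y q0 Mq.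
pose m := (p + d)%N.
pose H : 'M[R]_m := dsum H1 H2.
pose S : 'M[R]_m := dsum 1%:M (- 1%:M).
have [E [E0 ET dE cE]] : real_log T H (dsum K1 K2) by exact: real_log_dsum.
have SS : S *m S = 1%:M.
  by rewrite mul_dsum mulmx1 mulNmx mulmxN mulmx1 opprK -scalar_mx_block.
have SH : S *m H = H *m S by rewrite !mul_dsum !mul1mx !mulmx1 mulNmx mulmxN mul1mx mulmx1.
have KE : dsum K1 (- K2) = E T *m S by rewrite ET mul_dsum mulmx1 mulmxN mulmx1.
pose A t := jacobian_cV f (phi t).
have AT t : A (t + T) = A t by rewrite /A pT.
pose U t := Phi t *m Q *m E (- t).
have dU (t : R) : is_derive t 1 U (A t *m U t - U t *m H).
  have := is_derive_mulmx (is_derive_mulmxr Q (fundamental_is_derive hPhi t)) (is_derive_flowN dE t).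
  by rewrite /U mulmxN cE !mulmxA.
(* [S] commutes with the block diagonal [H], hence with its flow; so [E T] cancels across [S] and
   only the sign change remains after a period. *)
have SE t : S *m E t = E t *m S by exact: (flow_comm E0 dE cE).
have UT t : U (t + T) = U t *m S.
  have e : E T *m S *m E (- (t + T)) = E (- t) *m S.
    rewrite opprD addrC (flowD E0 dE cE) -(SE T) -!mulmxA [E T *m _]mulmxA.
    by rewrite (flowKN E0 dE cE) mul1mx SE.
  by rewrite /U (monodromy_period hPhi AT) -(mulmxA (Phi t)) MQ KE -!mulmxA [E T *m _]mulmxA e.
(* The Jacobian costs one derivative, which the linear equation for [U] restores. *)
have Ac : forall i j, Ck_curve r.-1 (fun t => A t i j).
  move=> i j.
  have := @Ck_curve_comp_flow R _ r D f phi Cf Dp dphi r.-1 (fun x => 'D_(delta_mx j 0) f x).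
  move=> /(_ (leq_pred _)) h.
  rewrite (_ : (fun t => _) = fun t => 'D_(delta_mx j 0) f (phi t) i 0); last first.
    by apply/funext => t; rewrite mxE.
  apply: h; apply: Ck_open_derive; by rewrite prednK // (leq_trans _ r2).
have A_continuous : continuous A.
  by move=> t; apply/continuous_mxP => i j; apply: Ck_curve_continuous (Ac i j) t.
have S_norm := @sign_mx_norm R p d.
have uF s : frame f phi U s \in unitmx.
  (* The frame is [Phi s] times the constant basis [[q | Q]] times an invertible block matrix. *)
  have -> : frame f phi U s = Phi s *m row_mx q Q *m dsum 1%:M (E (- s)).
    rewrite /frame qE mul_mx_row mul_row_block mulmx1 !mulmx0 addr0 add0r.
    by [].
  rewrite !unitmx_mul uPhi uQ unitmxE det_ublock det1 mul1r -unitmxE.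
  by have [] := mulmx1_unit (flowNK E0 dE cE s).
have [delta [C [d0 C0 good]]] :=
  good_radius T0 Cf1 Dp dphi pT dU UT A_continuous SS SH S_norm uF.
(* All three components are kept in one vector, so each estimate and each symmetry is proved once
   and then read off by slices. *)
pose L s v w := unperturbed f phi H U s (col_mx v w).
pose Lt t s v w := pullback f phi H U s (col_mx v w) (g t (point phi U s (col_mx v w))).
exists U, H1, H2.
exists (fun s v w => L s v w ord0 0), (fun s v w => usubmx (dsubmx (L s v w))),
  (fun s v w => dsubmx (dsubmx (L s v w))).
exists (fun t s v w => Lt t s v w ord0 0), (fun t s v w => usubmx (dsubmx (Lt t s v w))),
  (fun t s v w => dsubmx (dsubmx (Lt t s v w))).
exists delta, C.
split.
  exists setT, U; split=> //; split=> //; apply: Ck_open_curve.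
  have := Ck_curve_linear_ode Ac dU; rewrite prednK //; exact: leq_trans r2.
split; first exact: UT.
split.
  by move=> s; have [_ ->] := dp s; apply: mxrank_unit (uF s).
split=> //.
split.
  by move=> s x xd; have [] := good s x xd.
split.
  move=> a b s v w _ hyps.
  have key t : a < t < b ->
    (derivable (fun t => point phi U (s t) (col_mx (v t) (w t))) t 1 /\
     derive1 (fun t => point phi U (s t) (col_mx (v t) (w t))) t =
       f (point phi U (s t) (col_mx (v t) (w t))) +
       g t (point phi U (s t) (col_mx (v t) (w t)))) <->
    [/\ derive1 s t = 1 + L (s t) (v t) (w t) ord0 0 + Lt t (s t) (v t) (w t) ord0 0,
        derive1 v t = H1 *m v t + usubmx (dsubmx (L (s t) (v t) (w t)))
                      + usubmx (dsubmx (Lt t (s t) (v t) (w t))) &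
        derive1 w t = H2 *m w t + dsubmx (dsubmx (L (s t) (v t) (w t)))
                      + dsubmx (dsubmx (Lt t (s t) (v t) (w t)))].
    move=> tab; have [ds dv dw xd] := hyps t tab.
    have hs : is_derive t 1 s (derive1 s t) by apply/is_derive_derive1.
    have hv : is_derive t 1 v (derive1 v t) by apply/is_derive_derive1.
    have hw : is_derive t 1 w (derive1 w t) by apply/is_derive_derive1.
    rewrite (point_ode dphi dU uF _ (good (s t)) xd hs (is_derive_col_mx hv hw)).
    rewrite -/(L (s t) (v t) (w t)) -/(Lt t (s t) (v t) (w t)) cV3_eqP.
    move: (L (s t) (v t) (w t)) (Lt t (s t) (v t) (w t)) => l lt.
    rewrite !dsubmxD !usubmxD !col_mxKd !col_mxKu.
    rewrite /H mul_block_col !mul0mx addr0 add0r col_mxKd col_mxKu.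
    rewrite col_mx_ord0 [X in _ = X]mxE [X in _ = X + _]mxE col_mx_ord0.
    by rewrite !mxE !mulr1n.
  by split=> h t tab; apply/key => //; apply: h.
split; first exact: ex.
split.
  move=> s; have L00 : L s 0 0 = 0 by rewrite /L col_mx0 unperturbed0.
  have small e : 0 < e -> \forall y \near (0 : 'cV[R]_(p + d)),
      `|L s (usubmx y) (dsubmx y)| <= e * `|y|.
    move=> e0; have := unperturbed_small Cf1 Dp uF d0 C0 (good s) e0.
    by apply: filterS => y; rewrite /L vsubmxK.
  have z0 : L s (usubmx (0 : 'cV[R]_(p + d))) (dsubmx (0 : 'cV[R]_(p + d))) = 0.
    by rewrite /L vsubmxK unperturbed0.
  split; first by rewrite L00; split; rewrite ?mxE //; apply/matrixP => i j; rewrite !mxE.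
  split; apply: zero_diff_at0P; rewrite ?z0;
    try by [rewrite mxE|apply/matrixP => i j; rewrite !mxE].
  - move=> e e0; apply: filterS (small e e0) => y; apply: le_trans.
    exact: mx_entry_norm.
  - move=> e e0; apply: filterS (small e e0) => y; apply: le_trans.
    exact: le_trans (norm_usubmx _) (norm_dsubmx _).
  - move=> e e0; apply: filterS (small e e0) => y; apply: le_trans.
    exact: le_trans (norm_dsubmx _) (norm_dsubmx _).
split.
  move=> s v w _.
  have -> : L (s + T) v w = twist S *m L s v (- w).
    by rewrite /L (unperturbedT pT UT SS SH uF) mul_sign_mx col_mxKu col_mxKd.
  by rewrite twist0 dsubmx_twist mul_sign_mx col_mxKu col_mxKd.
split.
  move=> t s v w _ _.
  have -> : Lt t (s + T) v w = twist S *m Lt t s v (- w).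
    by rewrite /Lt (pullbackT pT UT SS SH uF) (pointT pT UT) mul_sign_mx col_mxKu col_mxKd.
  by rewrite twist0 dsubmx_twist mul_sign_mx col_mxKu col_mxKd.
split=> //.
move=> t s v w _ xd gz; have [_ _ b] := good s _ xd.
have hb : `|Lt t s v w| <= C * gz by exact: b.
split; apply: le_trans hb.
- exact: mx_entry_norm.
- exact: le_trans (norm_usubmx _) (norm_dsubmx _).
- exact: le_trans (norm_dsubmx _) (norm_dsubmx _).
Qed.
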